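(* Let $n\ge 2$, let $(v,x)\in\mathfrak{N}$ with $\mathrm{eType}(v,x)=((n-1,1),\varnothing)$, and let $2\le i\le n$. Then the irreducible component $\overline{C_n^i}$ of $\mathcal{C}_{(v,x)}$ is a $\mathbb{P}^1$-bundle over $\mathbb{P}^1$.
   Context: All varieties are over $\mathbb{C}$. Let $U$ be an $n$-dimensional complex vector space and $V=U\oplus U^*$ with the symplectic form $\langle (u,f),(u',f')\rangle=f'(u)-f(u')$; $W^\perp$ denotes the perpendicular space of $W$. Let $\mathcal{S}=\{x\in\mathrm{End}(V): \langle xv,w\rangle=\langle v,xw\rangle\ \forall v,w\in V\}$. The exotic nilpotent cone is $\mathfrak{N}=\{(v,x): v\in V,\ x\in\mathcal{S},\ x \text{ nilpotent}\}$; the same definitions apply to any finite-dimensional symplectic space. Exotic type. A bipartition of $n$ is a pair $(\mu,\nu)$ of partitions with $|\mu|+|\nu|=n$; let $\lambda=\mu+\nu$ (partwise sum) and $\ell(\cdot)$ be the number of nonzero parts. One writes $\mathrm{eType}(v,x)=(\mu,\nu)$ iff $V$ has a basis $\{v_{ij},v_{ij}^*: 1\le i\le \ell(\lambda),1\le j\le \lambda_i\}$ with $\langle v_{ij},v^*_{i'j'}\rangle=\delta_{ii'}\delta_{jj'}$, $\langle v_{ij},v_{i'j'}\rangle=\langle v^*_{ij},v^*_{i'j'}\rangle=0$, $v=\sum_{i=1}^{\ell(\mu)}v_{i,\mu_i}$, $xv_{ij}=v_{i,j-1}$ (zero if $j=1$), $xv^*_{ij}=v^*_{i,j+1}$ (zero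 if $j=\lambda_i$). Every $(v,x)\in\mathfrak{N}$ has a unique exotic type. Exotic Springer fibre. $\mathcal{C}_{(v,x)}$ is the variety of complete flags $F_\bullet=(0=F_0\subset F_1\subset\dots\subset F_{2n}=V)$, $\dim F_i=i$, with $F_i^\perp=F_{2n-i}$, $v\in F_n$, and $x(F_i)\subseteq F_{i-1}$ for all $i\ge1$. For $0\le k\le n$ put $\Phi^k(F_\bullet)=\mathrm{eType}(v+F_k,x|_{F_k^\perp/F_k})$, a bipartition of $n-k$, computed in the symplectic space $F_k^\perp/F_k$. For a standard bitableau $T$ with $n$ boxes (a pair of tableaux filled with $1,\dots,n$, each used once, increasing along rows and down columns), $\Phi^{-1}(T)$ is the set of $F_\bullet\in\mathcal{C}_{(v,x)}$ such that for every $0\le k\le n$, $\Phi^{n-k}(F_\bullet)$ is the shape formed by the entries $\le k$ of $T$. For $2\le i\le n$, let $T_n^i$ be the standard bitableau of shape $((n-1,1),\varnothing)$ with $\{1,\dots,n\}\setminus\{i\}$ in the first row and $i$ in the second row. Put $C_n^i=\Phi^{-1}(T_n^i)$, and let $\overline{C_n^i}$ be its closure in $\mathcal{C}_{(v,x)}$ (an irreducible component of $\mathcal{C}_{(v,x)}$). *)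

(* Defs.v *)
From HB Require Import structures.
From mathcomp Require Import all_boot all_order all_algebra.
From mathcomp Require Import boolp classical_sets reals complex mpoly.

Set Implicit Arguments.
Unset Strict Implicit.
Unset Printing Implicit Defensive.

Import GRing.Theory.
Local Open Scope classical_set_scope.
Local Open Scope ring_scope.

(******************************************************************************)
(* Varieties, in the sense of spaces with regular functions.                  *)
(*                                                                            *)
(* A variety is presented by homogeneous coordinates: a set [coords] of       *)
(* vectors of a finite-dimensional space, and the map [pt] sending coordinates*)
(* to the point they represent.  The set of points carries the quotient       *)
(* structure: a set of points is open iff its preimage is Zariski open in     *)
(* [coords], and a function is regular iff its pullback is locally a quotient *)
(* of polynomials.  For K^2 \ 0 -> P^1, for frames -> complete flags (that is,*)
(* GL(V) -> GL(V)/B), for the restrictions of these maps to the preimage of a *)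
(* locally closed set of points, and for products of such maps, this is the   *)
(* usual (reduced) structure: these maps have sections locally on the target. *)
(******************************************************************************)
Section Varieties.
Variable K : fieldType.

Definition polyfun (E : vectType K) (f : E -> K) : Prop :=
  exists p : {mpoly K[\dim {:E}]},
    forall a, f a = p.@[fun i => coord (vbasis {:E}) i a].

Record variety := Variety {
  ambient : vectType K;
  coords : set ambient;
  point : Type;
  pt : ambient -> point }.

Definition points (X : variety) : set (point X) := @pt X @` @coords X.

Definition cone (X : variety) (W : set (point X)) : set (ambient X) :=
  [set a | coords a /\ W (pt a)].

Definition zopen (X : variety) (W : set (point X)) : Prop :=
  W `<=` @points X /\
  forall a, cone W a -> exists q : ambient X -> K,
    [/\ polyfun q, q a != 0 & forall b, coords b -> q b != 0 -> cone W b].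

Definition regular (X : variety) (W : set (point X)) (h : point X -> K) :
    Prop :=
  forall a, cone W a -> exists p q : ambient X -> K,
    [/\ polyfun p, polyfun q, q a != 0 &
        forall b, cone W b -> q b != 0 -> h (pt b) = p b / q b].

Definition zclosure (X : variety) (A : set (point X)) : set (point X) :=
  [set x | @points X x /\ forall W, zopen W -> W x -> W `&` A !=set0].

Definition subvariety (X : variety) (S : set (point X)) : variety :=
  @Variety (ambient X) (cone S) (point X) (@pt X).

Definition prodvariety (X Y : variety) : variety :=
  @Variety (ambient X * ambient Y)%type
    [set a | coords a.1 /\ coords a.2] (point X * point Y)%type
    (fun a => (pt a.1, pt a.2)).

(* only the values of f on the points of X are relevant *)
Definition morphism (X Y : variety) (f : point X -> point Y) : Prop :=
  (forall x, @points X x -> @points Y (f x)) /\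
  forall W : set (point Y), zopen W ->
    zopen (@points X `&` f @^-1` W) /\
    forall h, regular W h -> regular (@points X `&` f @^-1` W) (h \o f).

Definition isomorphism (X Y : variety) (f : point X -> point Y) : Prop :=
  morphism f /\ exists g : point Y -> point X,
    [/\ morphism g, (forall x, @points X x -> g (f x) = x) &
        (forall y, @points Y y -> f (g y) = y)].

Definition P1 : variety :=
  @Variety 'rV[K]_2 [set a | a != 0] {vspace 'rV[K]_2} (fun a => <[a]>%VS).

(* fibre bundle with fibre P^1, locally trivial for the Zariski topology *)
Definition P1_bundle (X B : variety) (p : point X -> point B) : Prop :=
  @morphism X B p /\
  forall b, @points B b -> exists W : set (point B),
    [/\ zopen W, W b &
     exists f : point X -> point B * point P1,
       @isomorphism (@subvariety X (@points X `&` p @^-1` W))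
                    (prodvariety (@subvariety B W) P1) f /\
       forall x, @points X x -> W (p x) -> (f x).1 = p x].

Definition is_P1_bundle_over (X B : variety) : Prop :=
  exists p : point X -> point B, P1_bundle p.

(* The coordinates of a complete flag are the bases adapted to it. *)
Definition flags (V : vectType K) (m : nat) : variety :=
  @Variety {ffun 'I_m -> V} [set e | basis_of {:V} (codom e)]
    {ffun 'I_m.+1 -> {vspace V}}
    (fun e => [ffun k : 'I_m.+1 => (\sum_(j < m | (j < k)%N) <[e j]>)%VS]).

End Varieties.

Definition bipartition := (seq nat * seq nat)%type.

Definition is_partition (s : seq nat) : bool := sorted geq s && (0%N \notin s).

(* a tableau is the list of its rows *)
Definition bitableau := (seq (seq nat) * seq (seq nat))%type.

(* shape of the subtableau of entries <= k: rows that become empty are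
   dropped *)
Definition shape_le (k : nat) (t : seq (seq nat)) : seq nat :=
  [seq m <- [seq count (fun e => (e <= k)%N) row | row <- t] | (0 < m)%N].

Definition bishape_le (k : nat) (T : bitableau) : bipartition :=
  (shape_le k T.1, shape_le k T.2).

Definition T_ (n i : nat) : bitableau :=
  ([:: [seq j <- iota 1 n | j != i]; [:: i]], [::]).

Section SymplecticSpace.
Variables (K : fieldType) (V : vectType K) (om : V -> V -> K).

Definition perp (F : {vspace V}) : {vspace V} :=
  (\bigcap_(j < \dim F) lker (linfun (om (vbasis F)`_j : V -> K^o)))%VS.

Definition exotic_nilcone (v : V) (x : 'End(V)) : Prop :=
  (forall a b, om (x a) b = om a (x b)) /\
  (exists k, forall a, iter k x a = 0).

(* The rows i are numbered from 0 and the columns j from 1, so that           *)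
(* b i j is v_{i+1,j} and bs i j is v*_{i+1,j}.                               *)
Definition eType (v : V) (x : 'End(V)) (munu : bipartition) : Prop :=
  let: (mu, nu) := munu in
  let lam i := (nth 0 mu i + nth 0 nu i)%N in
  let boxes := [seq (i, j) | i <- iota 0 (maxn (size mu) (size nu)),
                             j <- iota 1 (lam i)] in
  [/\ is_partition mu, is_partition nu &
   exists b bs : nat -> nat -> V,
   [/\ basis_of {:V} ([seq b c.1 c.2 | c <- boxes] ++
                      [seq bs c.1 c.2 | c <- boxes]),
       {in boxes &, forall c d,
         [/\ om (b c.1 c.2) (bs d.1 d.2) = (c == d)%:R,
             om (b c.1 c.2) (b d.1 d.2) = 0 &
             om (bs c.1 c.2) (bs d.1 d.2) = 0]},
       v = \sum_(i < size mu) b i (nth 0%N mu i),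
       {in boxes, forall c,
         x (b c.1 c.2) = if c.2 == 1%N then 0 else b c.1 c.2.-1} &
       {in boxes, forall c,
         x (bs c.1 c.2) = if c.2 == lam c.1 then 0 else bs c.1 c.2.+1}]].

(* For F isotropic, F^perp / F is realised as a complement of F in F^perp,    *)
(* the class of a vector of F^perp being its projection along F.              *)
Definition perp_quo (F : {vspace V}) : vectType K :=
  subvs_of (perp F :\: F)%VS.

Definition to_quo (F : {vspace V}) (a : V) : perp_quo F :=
  vsproj (perp F :\: F)%VS (addv_pi1 (perp F) F a).

Definition quo_form (F : {vspace V}) (a b : perp_quo F) : K :=
  om (vsval a) (vsval b).

Definition quo_end (F : {vspace V}) (x : 'End(V)) : 'End(perp_quo F) :=
  linfun (fun a : perp_quo F => to_quo F (x (vsval a))).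

End SymplecticSpace.

Section SymplecticSpaceTheory.
Variables (K : fieldType) (V : vectType K) (om : V -> V -> K).
Hypothesis om_linl : forall c, linear (om^~ c : V -> K^o).
Hypothesis om_linr : forall b, linear (om b : V -> K^o).

Lemma perpP (F : {vspace V}) (a : V) :
  reflect (forall b, b \in F -> om b a = 0) (a \in perp om F).
Proof.
have linE b : linfun (om b : V -> K^o) a = om b a.
  pose M := GRing.isLinear.Build _ _ _ _ (om b : V -> K^o) (om_linr b).
  pose f : {linear V -> K^o} := HB.pack (om b : V -> K^o) M.
  exact: (lfunE f).
pose M := GRing.isLinear.Build _ _ _ _ (om^~ a : V -> K^o) (om_linl a).
pose g : {linear V -> K^o} := HB.pack (om^~ a : V -> K^o) M.
apply: (iffP idP) => [aF b bF|aF]; last first.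
  rewrite memvE; apply/subv_bigcapP => j _; rewrite -memvE memv_ker linE.
  by rewrite aF // vbasis_mem // mem_nth // size_tuple.
have -> : om b a = g b by [].
rewrite (coord_vbasis bF) linear_sum big1 // => j _; rewrite linearZ /=.
move: aF; rewrite memvE => /subv_bigcapP/(_ j isT).
by rewrite -memvE memv_ker linE => /eqP ->; rewrite scaler0.
Qed.

Variable F : {vspace V}.

Lemma to_quo_val (w : perp_quo om F) : to_quo om F (vsval w) = w.
Proof.
by rewrite /to_quo /addv_pi1 daddv_pi_id ?capv_diff ?subvsP // vsvalK.
Qed.

Lemma to_quo_mod (a : V) : a \in perp om F -> a - vsval (to_quo om F a) \in F.
Proof.
move=> aF; rewrite vsprojK ?memv_pi //.
rewrite -{1}(@addv_pi1_pi2 _ _ (perp om F) F a) ?(subvP (addvSl _ _)) //.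
by rewrite addrC addKr memv_pi2.
Qed.

Lemma to_quo_eq0 (a : V) : a \in perp om F -> (to_quo om F a == 0) = (a \in F).
Proof.
move=> aF; apply/eqP/idP => [a0|a_F].
  by have := to_quo_mod aF; rewrite a0 /= subr0.
rewrite /to_quo; suff -> : addv_pi1 (perp om F) F a = 0 by rewrite linear0.
have aFF : a \in (perp om F + F)%VS by rewrite (subvP (addvSl _ _)).
have := addv_pi1_pi2 aFF; rewrite (addv_pi2_id _ a_F) => /eqP.
by rewrite -subr_eq0 addrK => /eqP.
Qed.

Lemma quo_formE (a b : V) : (forall c d, om c d = - om d c) ->
  (F <= perp om F)%VS -> a \in perp om F -> b \in perp om F ->
  quo_form (to_quo om F a) (to_quo om F b) = om a b.
Proof.
move=> omN Fiso aF bF; rewrite /quo_form.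
set a' := vsval _; set b' := vsval _.
have b'F : b' \in perp om F by exact: (subvP (diffvSl _ _) _ (subvsP _)).
have subl c d e : om (c - d) e = om c e - om d e.
  have := om_linl e (-1) d c; rewrite !scaleN1r addrC (addrC c) => ->.
  by rewrite addrC.
have subr c d e : om e (c - d) = om e c - om e d.
  by rewrite omN subl opprB (omN e c) (omN e d) opprK addrC.
have -> : om a b = om a b'.
  apply/eqP; rewrite -subr_eq0 -subr omN; move/perpP: aF => -> //.
    by rewrite oppr0.
  exact: to_quo_mod.
apply/esym/eqP; rewrite -subr_eq0 -subl; move/perpP: b'F => -> //.
exact: to_quo_mod.
Qed.

Lemma quo_endE (x : 'End(V)) (a : V) :
  (x @: F <= F)%VS -> (x @: perp om F <= perp om F)%VS -> a \in perp om F ->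
  quo_end om F x (to_quo om F a) = to_quo om F (x a).
Proof.
move=> xF xpF aF.
have toD : linear (to_quo om F) by move=> k c d; rewrite /to_quo !linearP.
have lin : linear (fun w : perp_quo om F => to_quo om F (x (vsval w))).
  by move=> k c d; rewrite -toD -linearP.
pose M := GRing.isLinear.Build _ _ _ _
  (fun w : perp_quo om F => to_quo om F (x (vsval w))) lin.
pose f : {linear perp_quo om F -> perp_quo om F} :=
  HB.pack (fun w : perp_quo om F => to_quo om F (x (vsval w))) M.
have -> : quo_end om F x (to_quo om F a) = f (to_quo om F a).
  exact: (lfunE f).
have xa' : x (a - vsval (to_quo om F a)) \in F.
  by rewrite (subvP xF) ?memv_img ?to_quo_mod.
have x_a' : x (a - vsval (to_quo om F a)) \in perp om F.
  rewrite (subvP xpF) ?memv_img ?rpredB //.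
  exact: (subvP (diffvSl _ _) _ (subvsP _)).
move: xa'; rewrite -(to_quo_eq0 x_a') => /eqP xa'.
have <- : a - vsval (to_quo om F a) + vsval (to_quo om F a) = a.
  by rewrite subrK.
have := toD 1 (x (a - vsval (to_quo om F a))) (x (vsval (to_quo om F a))).
rewrite xa' scaler0 add0r scale1r -linearD subrK => ->.
by rewrite /f.
Qed.

End SymplecticSpaceTheory.

Section ExoticSpringerFibre.
Variables (K : fieldType) (U : vectType K).

Definition plus_dual : vectType K := (U * 'Hom(U, K^o))%type.

Definition sform (a b : plus_dual) : K := b.2 a.1 - a.2 b.1.

Local Notation flagvar n := (flags plus_dual n.*2).
Local Notation flag n := {ffun 'I_(n.*2).+1 -> {vspace plus_dual}}.

(* rev_ord k is 2n - k *)
Definition springer_fibre (n : nat) (v : plus_dual) (x : 'End(plus_dual)) :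
    set (flag n) :=
  [set F : flag n |
    [/\ (forall k, \dim (F k) = k),
        (forall j k : 'I_(n.*2).+1, (j <= k)%N -> (F j <= F k)%VS),
        (forall k, perp sform (F k) = F (rev_ord k)),
        v \in F (inord n) &
        forall j k : 'I_(n.*2).+1, k = j.+1 :> nat -> (x @: F k <= F j)%VS]].

Definition Phi_is (n : nat) (v : plus_dual) (x : 'End(plus_dual)) (k : nat)
    (F : flag n) (munu : bipartition) : Prop :=
  let Fk := F (inord k) in
  eType (@quo_form _ _ sform Fk) (to_quo sform Fk v) (quo_end sform Fk x) munu.

Definition Phi_preim (n : nat) (v : plus_dual) (x : 'End(plus_dual))
    (T : bitableau) : set (flag n) :=
  [set F : flag n | springer_fibre v x F /\
    forall k, (k <= n)%N -> Phi_is v x (n - k) F (bishape_le k T)].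

Definition closure_in_fibre (n : nat) (v : plus_dual) (x : 'End(plus_dual))
    (A : set (flag n)) : set (flag n) :=
  @zclosure _ (@subvariety _ (flagvar n) (@springer_fibre n v x)) A.

End ExoticSpringerFibre.

(* Main.v *)
From HB Require Import structures.
From mathcomp Require Import all_boot all_order all_algebra.
From mathcomp Require Import boolp classical_sets reals complex mpoly zify ring.
Require Import Defs.

Set Implicit Arguments.
Unset Strict Implicit.
Unset Printing Implicit Defensive.

Import GRing.Theory.
Local Open Scope classical_set_scope.
Local Open Scope ring_scope.

(* Put n = p + 2 and m = n - i.  V is the orthogonal sum of a pair of dual Jordan
   chains e_0, ..., e_p = v and f_0, ..., f_p and of a plane <z, w> killed by x.
   The closure of the cell is D = {F | x F_{m+2} <= F_m}.  A flag of D has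
   F_k = <e_0, ..., e_{k-1}> for k <= m and F_k = <e_0, ..., e_{k-2}, u> for
   m + 2 <= k <= n, with u in <z, w>, and F_{m+1} lies between F_m and F_{m+2} =
   F_m + <e_m, u>: it amounts to a line <u> and a line in <e_m, u>, and the
   cell is the open part where e_m is not in F_{m+1}.  A basis adapted to such a
   flag depends polynomially on homogeneous coordinates of the two lines, which
   gives the local trivializations and, moving F_{m+1} along its line, the density
   of the cell. *)

(** * Polynomial maps and morphisms *)

(** Openness and regularity are defined by pullback to coordinates, so maps of varieties are handled
    through polynomial maps of coordinates that lift them near each point. The inclusion of x
    F_{m+2} in F_m arises from two shapes only, those of the entries <= i and <= i - 1 of the
    tableau. They say that x^(n-m-1) v = x e_m lies in F_m and that x^(n-m-2) v = e_m does not lie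
    in F_{m+1}. As e_m always lies in F_{m+2}, this forces F_{m+2} = F_{m+1} + <e_m>, hence the
    inclusion. The inclusion is a closed condition, the position of e_m an open one. The bundle map
    sends F to the projection of F_n to <z, w>, which is <u>. The obstacle to a product structure is
    that identifying <e_m, u> with K^2 takes a generator u of the line, and no choice works over all
    of P^1. Over the chart where a linear form g is nonzero on the line, g normalises u; this is why
    g occurs in every formula for a frame. Characteristic 0 enters twice: 2 is invertible, so the
    vectors x^j v are mutually orthogonal, and K is infinite, so a nonempty open part of a line is
    dense in it. *)

Section PolynomialMaps.
Variable K : fieldType.
Implicit Types E : vectType K.

Lemma polyfun_cst E (c : K) : polyfun (fun _ : E => c).
Proof. by exists c%:MP => a; rewrite mevalC. Qed.

Lemma polyfun_add E (p q : E -> K) :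
  polyfun p -> polyfun q -> polyfun (fun a => p a + q a).
Proof. by move=> [P hP] [Q hQ]; exists (P + Q) => a; rewrite mevalD hP hQ. Qed.

Lemma polyfun_mul E (p q : E -> K) :
  polyfun p -> polyfun q -> polyfun (fun a => p a * q a).
Proof. by move=> [P hP] [Q hQ]; exists (P * Q) => a; rewrite mevalM hP hQ. Qed.

Lemma polyfun_exp E (p : E -> K) k :
  polyfun p -> polyfun (fun a => p a ^+ k).
Proof. by move=> [P hP]; exists (P ^+ k) => a; rewrite rmorphXn /= hP. Qed.

Lemma polyfun_sum E I (r : seq I) (F : I -> E -> K) :
  (forall i, polyfun (F i)) -> polyfun (fun a => \sum_(i <- r) F i a).
Proof.
move=> hF; elim: r => [|i r IH].
  have -> : (fun a => \sum_(i <- [::]) F i a) = (fun=> 0).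
    by apply/funext => a; rewrite big_nil.
  exact: polyfun_cst.
have -> : (fun a => \sum_(j <- i :: r) F j a) =
          (fun a => F i a + \sum_(j <- r) F j a).
  by apply/funext => a; rewrite big_cons.
exact: polyfun_add.
Qed.

Lemma polyfun_prod E I (r : seq I) (F : I -> E -> K) :
  (forall i, polyfun (F i)) -> polyfun (fun a => \prod_(i <- r) F i a).
Proof.
move=> hF; elim: r => [|i r IH].
  have -> : (fun a => \prod_(i <- [::]) F i a) = (fun=> 1).
    by apply/funext => a; rewrite big_nil.
  exact: polyfun_cst.
have -> : (fun a => \prod_(j <- i :: r) F j a) =
          (fun a => F i a * \prod_(j <- r) F j a).
  by apply/funext => a; rewrite big_cons.
exact: polyfun_mul.
Qed.

Lemma polyfun_coord E i : polyfun (coord (vbasis {:E}) i).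
Proof. by exists 'X_i => a; rewrite mevalXU. Qed.

Lemma polyfun_linear E (l : {linear E -> K^o}) : polyfun (l : E -> K).
Proof.
have -> : (l : E -> K) =
    (fun a => \sum_(i < \dim {:E}) coord (vbasis {:E}) i a * l (vbasis {:E})`_i).
  apply/funext => a; rewrite {1}(coord_vbasis (memvf a)) linear_sum.
  by apply: eq_bigr => i _; rewrite linearZ.
apply: polyfun_sum => i; apply: polyfun_mul; first exact: polyfun_coord.
exact: polyfun_cst.
Qed.

Lemma polyfun_lin E (h : E -> K) :
  linear (h : E -> K^o) -> polyfun h.
Proof.
move=> hl; pose l : {linear E -> K^o} := HB.pack (h : E -> K^o)
  (GRing.isLinear.Build _ _ _ _ (h : E -> K^o) hl).
exact: (polyfun_linear l).
Qed.

(** Testing against all linear forms keeps the notion free of a choice of coordinates on the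
    target. *)
Definition polymap E E' (phi : E -> E') : Prop :=
  forall l : {linear E' -> K^o}, polyfun (fun a => l (phi a) : K).

Lemma polyfun_comp E E' (phi : E -> E') (q : E' -> K) :
  polymap phi -> polyfun q -> polyfun (fun a => q (phi a)).
Proof.
move=> hphi [Q hQ].
have -> : (fun a => q (phi a)) = (fun a => \sum_(mm <- msupp Q)
    (fun b => Q@_mm * \prod_(i <- index_enum 'I_(\dim {:E'}))
       (fun b => coord (vbasis {:E'}) i (phi b) ^+ mm i) b) a).
  by apply/funext => a; rewrite hQ mevalE.
apply: polyfun_sum => mm; apply: polyfun_mul; first exact: polyfun_cst.
apply: polyfun_prod => i; apply: polyfun_exp.
exact: (hphi (coord (vbasis {:E'}) i)).
Qed.

Lemma polymap_cst E E' (c : E') : polymap (fun _ : E => c).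
Proof. move=> l; exact: polyfun_cst. Qed.

Lemma polymap_lin E E' (h : E -> E') : linear h -> polymap h.
Proof.
move=> hl l; pose h' : {linear E -> E'} :=
  HB.pack h (GRing.isLinear.Build _ _ _ _ h hl).
exact: (polyfun_linear (l \o h')).
Qed.

Lemma polymap_ffun_at E (I : finType) (i : I) :
  polymap (fun b : {ffun I -> E} => b i).
Proof. by apply: polymap_lin => c a b; rewrite !ffunE. Qed.

Lemma polymap_add E E' (f g : E -> E') :
  polymap f -> polymap g -> polymap (fun a => f a + g a).
Proof.
move=> hf hg l.
have -> : (fun a => l (f a + g a) : K) = (fun a => (l (f a) : K) + (l (g a) : K)).
  by apply/funext => a; rewrite linearD.
exact: polyfun_add.
Qed.

Lemma polymap_scale E E' (q : E -> K) (f : E -> E') :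
  polyfun q -> polymap f -> polymap (fun a => q a *: f a).
Proof.
move=> hq hf l.
have -> : (fun a => l (q a *: f a) : K) = (fun a => q a * (l (f a) : K)).
  by apply/funext => a; rewrite linearZ.
exact: polyfun_mul.
Qed.

Lemma polymap_ffun E E' (I : finType) (f : I -> E -> E') :
  (forall i, polymap (f i)) ->
  polymap (fun a => [ffun i => f i a] : {ffun I -> E'}).
Proof.
move=> hf l.
pose d i (w : E') : {ffun I -> E'} := [ffun j => if j == i then w else 0].
have dlin i : linear (d i).
  move=> c u w; apply/ffunP => j; rewrite !ffunE.
  by case: (j == i); rewrite ?scaler0 ?addr0.
(* [L i] puts a vector into slot [i]; through these maps a linear form on the function space splits
   into one form for each slot. *)
pose L i : {linear E' -> {ffun I -> E'}} :=
  HB.pack (d i) (GRing.isLinear.Build _ _ _ _ (d i) (dlin i)).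
have -> : (fun a => l [ffun i => f i a] : K) =
          (fun a => \sum_(i <- index_enum I) ((l \o L i) (f i a) : K)).
  apply/funext => a /=.
  have -> : [ffun i => f i a] = \sum_i d i (f i a).
    apply/ffunP => j; rewrite ffunE sum_ffunE (bigD1 j) //= ffunE eqxx.
    by rewrite big1 ?addr0 // => i ij; rewrite ffunE eq_sym (negbTE ij).
  by rewrite linear_sum.
by apply: polyfun_sum => i; apply: hf.
Qed.

Lemma polymap_pair E E1 E2 (f : E -> E1) (g : E -> E2) :
  polymap f -> polymap g -> polymap (fun a => (f a, g a) : (E1 * E2)%type).
Proof.
move=> hf hg l.
have lin1 : linear (fun w : E1 => (w, 0) : (E1 * E2)%type).
  by move=> c u w; congr pair; rewrite /= ?scaler0 ?addr0.
have lin2 : linear (fun w : E2 => (0, w) : (E1 * E2)%type).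
  by move=> c u w; congr pair; rewrite /= ?scaler0 ?addr0.
pose L1 : {linear E1 -> (E1 * E2)%type} :=
  HB.pack (fun w : E1 => (w, 0) : (E1 * E2)%type)
    (GRing.isLinear.Build _ _ _ _ _ lin1).
pose L2 : {linear E2 -> (E1 * E2)%type} :=
  HB.pack (fun w : E2 => (0, w) : (E1 * E2)%type)
    (GRing.isLinear.Build _ _ _ _ _ lin2).
have -> : (fun a => l (f a, g a) : K) =
          (fun a => ((l \o L1) (f a) : K) + ((l \o L2) (g a) : K)).
  apply/funext => a /=; rewrite -[RHS]linearD; congr (l _).
  by congr pair; rewrite /= ?addr0 ?add0r.
by apply: polyfun_add; [exact: hf | exact: hg].
Qed.

(** Along the line, [q] is a nonzero polynomial in [c], which has finitely many roots. The density
    of the cell rests on this. *)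
Lemma polyfun_nonroot_line E (q : E -> K) (a d : E) :
  [pchar K] =i pred0 -> polyfun q -> q a != 0 ->
  exists2 c : K, c != 0 & q (a + c *: d) != 0.
Proof.
move=> /pcharf0P K0 [Q hQ] qa.
pose P : {poly K} := \sum_(mm <- msupp Q) (Q@_mm)%:P *
  \prod_(i < \dim {:E}) ((coord (vbasis {:E}) i a)%:P +
                         (coord (vbasis {:E}) i d)%:P * 'X) ^+ mm i.
have PE c : q (a + c *: d) = P.[c].
  rewrite hQ mevalE /P horner_sum; apply: eq_bigr => mm _.
  rewrite hornerM hornerC horner_prod; congr (_ * _); apply: eq_bigr => i _.
  by rewrite horner_exp !hornerE linearD linearZ /= mulrC.
have P0 : P != 0.
  apply: contraNneq qa => P0.
  by have := PE 0; rewrite scale0r addr0 P0 horner0 => ->.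
(* The candidates 1, ..., [size P] are nonzero and distinct in characteristic 0, and there is one
   more of them than the degree of [P]. *)
have [/allP h|/allPn[c]] :=
    boolP (all (root P) [seq k.+1%:R | k <- iota 0 (size P)]); last first.
  move=> /mapP[k _ ->]; rewrite /root -PE => h; exists k.+1%:R => //.
  by rewrite K0.
have := max_poly_roots P0 (introT allP h).
rewrite size_map size_iota ltnn => H; suff /H : 
  uniq [seq k.+1%:R : K | k <- iota 0 (size P)] by [].
rewrite map_inj_uniq ?iota_uniq // => i j /eqP.
wlog ij : i j / (i <= j)%N => [H'|].
  by case: (leqP i j) => [/H'//|/ltnW/H' h']; rewrite eq_sym => /h'.
rewrite eq_sym -subr_eq0 -natrB ?ltnS // K0 subn_eq0 ltnS => ji.
by apply/eqP; rewrite eqn_leq ij.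
Qed.

End PolynomialMaps.

(** * Morphisms and isomorphisms from local lifts to coordinates *)

Section Lifts.
Variable K : fieldType.

Lemma pointsE (X : variety K) (a : ambient X) : coords a -> points (pt a).
Proof. by move=> ha; exists a. Qed.

Lemma morphism_of_lifts (X Y : variety K) (f : point X -> point Y) :
  (forall a : ambient X, coords a ->
     exists (phi : ambient X -> ambient Y) (q : ambient X -> K),
     [/\ polymap phi, polyfun q, q a != 0 &
         forall b, coords b -> q b != 0 ->
           coords (phi b) /\ pt (phi b) = f (pt b)]) ->
  morphism f.
Proof.
move=> lift; split.
  move=> _ [a ha <-]; have [phi [q [_ _ qa /(_ a ha qa)[h <-]]]] := lift a ha.
  exact: pointsE.
move=> W [Wsub Wopen]; split.
  split; first by move=> x [].
  move=> a [ha [_ Wa]]; have [phi [q [hphi hq qa H]]] := lift a ha.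
  have [hpa pa] := H a ha qa.
  have [|q' [hq' q'a H']] := Wopen (phi a); first by split; rewrite // pa.
  exists (fun b => q b * q' (phi b)); split.
  - by apply: polyfun_mul => //; apply: polyfun_comp.
  - by rewrite mulf_neq0.
  - move=> b hb; rewrite mulf_eq0 negb_or => /andP[qb q'b].
    have [hpb pb] := H b hb qb.
    by split => //; split; [exact: pointsE | rewrite /= -pb;
      apply: (H' _ hpb q'b).2].
move=> h hreg a [ha [_ Wa]]; have [phi [q [hphi hq qa H]]] := lift a ha.
have [hpa pa] := H a ha qa.
have [|p' [q' [hp' hq' q'a H']]] := hreg (phi a); first by split; rewrite // pa.
(* The common factor [q] leaves the quotient unchanged and makes the denominator vanish wherever
   [phi] is not known to be a lift. *)
exists (fun b => q b * p' (phi b)), (fun b => q b * q' (phi b)); split.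
- by apply: polyfun_mul => //; apply: polyfun_comp.
- by apply: polyfun_mul => //; apply: polyfun_comp.
- by rewrite mulf_neq0.
- move=> b [hb [_ Wb]]; rewrite mulf_eq0 negb_or => /andP[qb q'b].
  have [hpb pb] := H b hb qb; rewrite /= -pb -mulf_div divff // mul1r.
  by apply: H' => //; split; rewrite // pb.
Qed.

(** The second family of lifts consists of local sections of [f], so [f] is surjective. By
    injectivity the set-theoretic inverse agrees with these sections and is therefore a morphism.
    [x0] only fills in the values of the inverse outside the points of [Y]. *)
Lemma isomorphism_of_lifts (X Y : variety K) (f : point X -> point Y)
    (x0 : point X) :
  (forall a : ambient X, coords a ->
     exists (phi : ambient X -> ambient Y) (q : ambient X -> K),
     [/\ polymap phi, polyfun q, q a != 0 &
         forall b, coords b -> q b != 0 ->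
           coords (phi b) /\ pt (phi b) = f (pt b)]) ->
  (forall a : ambient Y, coords a ->
     exists (phi : ambient Y -> ambient X) (q : ambient Y -> K),
     [/\ polymap phi, polyfun q, q a != 0 &
         forall b, coords b -> q b != 0 ->
           coords (phi b) /\ f (pt (phi b)) = pt b]) ->
  (forall x y, points x -> points y -> f x = f y -> x = y) ->
  isomorphism f.
Proof.
move=> lift lift' injf; split; first exact: morphism_of_lifts.
have ex y : exists x, points y -> points x /\ f x = y.
  have [[a ha <-]|ny] := pselect (points y); last by exists x0.
  have [phi [q [_ _ qa /(_ a ha qa)[h h']]]] := lift' a ha.
  by exists (pt (phi a)); split => //; apply: pointsE.
have [g hg] := choice ex.
have gf x : points x -> g (f x) = x.
  move=> hx; have hfx : points (f x).
    by case: (morphism_of_lifts lift) => + _; apply.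
  by have [hgf] := hg _ hfx; apply: injf.
exists g; split => //; last by move=> y /hg[].
apply: morphism_of_lifts => a ha.
have [phi [q [hphi hq qa H]]] := lift' a ha.
exists phi, q; split => // b hb qb; have [h <-] := H b hb qb.
by split => //; rewrite gf //; apply: pointsE.
Qed.

End Lifts.

(** * Alternating forms and exotic types *)

Section AlternatingForms.
Variable K : fieldType.

Definition alternating_form (V : vectType K) (om : V -> V -> K) : Prop :=
  [/\ (forall c, linear (om^~ c : V -> K^o)),
      (forall b, linear (om b : V -> K^o)) & forall a, om a a = 0].

Variables (V : vectType K) (om : V -> V -> K).
Hypothesis om_form : alternating_form om.

Let linl : forall c, linear (om^~ c : V -> K^o). Proof. by case: om_form. Qed.
Let linr : forall c, linear (om c : V -> K^o). Proof. by case: om_form. Qed.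
Let alt : forall a, om a a = 0. Proof. by case: om_form. Qed.

Lemma omDl a b c : om (a + b) c = om a c + om b c.
Proof. by have := linl c 1 a b; rewrite !scale1r. Qed.

Lemma omDr a b c : om c (a + b) = om c a + om c b.
Proof. by have := linr c 1 a b; rewrite !scale1r. Qed.

Lemma om0l c : om 0 c = 0.
Proof. by apply: (addrI (om 0 c)); rewrite -omDl !addr0. Qed.

Lemma om0r c : om c 0 = 0.
Proof. by apply: (addrI (om c 0)); rewrite -omDr !addr0. Qed.

Lemma omZl k a c : om (k *: a) c = k * om a c.
Proof. by have := linl c k a 0; rewrite !addr0 om0l addr0. Qed.

Lemma omZr k a c : om c (k *: a) = k * om c a.
Proof. by have := linr c k a 0; rewrite !addr0 om0r addr0. Qed.

Lemma omNl a c : om (- a) c = - om a c.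
Proof. by rewrite -scaleN1r omZl mulN1r. Qed.

Lemma omNr a c : om c (- a) = - om c a.
Proof. by rewrite -scaleN1r omZr mulN1r. Qed.

Definition omE := (omDl, omDr, omZl, omZr, omNl, omNr, om0l, om0r, alt).

Lemma om_suml I (r : seq I) (P : pred I) (F : I -> V) c :
  om (\sum_(i <- r | P i) F i) c = \sum_(i <- r | P i) om (F i) c.
Proof. by elim/big_rec2: _ => [|i y a _ <-]; rewrite ?om0l ?omDl. Qed.

Lemma om_sumr I (r : seq I) (P : pred I) (F : I -> V) c :
  om c (\sum_(i <- r | P i) F i) = \sum_(i <- r | P i) om c (F i).
Proof. by elim/big_rec2: _ => [|i y a _ <-]; rewrite ?om0r ?omDr. Qed.

Lemma omC a b : om a b = - om b a.
Proof.
apply/eqP; rewrite -addr_eq0; apply/eqP.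
by have := alt (a + b); rewrite !omE addr0 add0r.
Qed.

Lemma om_eq0C a b : om a b = 0 -> om b a = 0.
Proof. by rewrite omC => /eqP; rewrite oppr_eq0 => /eqP. Qed.

(** Pairing a linear relation with [d i] isolates its coefficient of index [i]. *)
Lemma dual_free (s : seq V) (d : nat -> V) :
  (forall i j, (i < size s)%N -> (j < size s)%N -> i != j ->
    om s`_i (d j) = 0) ->
  (forall i, (i < size s)%N -> om s`_i (d i) != 0) -> free s.
Proof.
move=> h0 h1; rewrite -[s]/(tval (in_tuple s)); apply/freeP => k;
  set S := \sum_(i < _) _ => S0 i.
have : om S (d i) = 0 by rewrite S0 om0l.
rewrite om_suml (bigD1 i) //= big1 => [|j ji]; last by rewrite omZl h0 ?mulr0.
rewrite addr0 omZl => /eqP.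
by rewrite mulf_eq0 (negbTE (h1 _ _)) ?orbF => // /eqP.
Qed.

Variable x : 'End(V).
Hypothesis x_adj : forall a b, om (x a) b = om a (x b).

Lemma iter_lin j k a b : iter j x (k *: a + b) = k *: iter j x a + iter j x b.
Proof. by elim: j => //= j ->; rewrite linearP. Qed.

Lemma iter0 j : iter j x 0 = 0.
Proof. by elim: j => //= j ->; rewrite linear0. Qed.

Lemma iter_eq0 r j a : iter r x a = 0 -> (r <= j)%N -> iter j x a = 0.
Proof. by move=> h /subnK <-; rewrite iterD h iter0. Qed.

Lemma iter_adj j a b : om (iter j x a) b = om a (iter j x b).
Proof. by elim: j a b => //= j IH a b; rewrite x_adj IH -iterSr. Qed.

(** Two dual Jordan chains of length [r], generated by [v] and [f]. By adjointness the pairings with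
    [f] alone determine all pairings between the chains. *)
Definition chain_pair r v f : Prop :=
  [/\ iter r x v = 0, iter r x f = 0 &
      forall j, (j < r)%N -> om (iter j x v) f = (j.+1 == r)%:R].

Lemma chain_pairE r v f i j : chain_pair r v f ->
  om (iter i x v) (iter j x f) = ((i + j).+1 == r)%:R.
Proof.
move=> [v0 f0 vf]; rewrite -iter_adj -iterD addnC.
have [h|h] := ltnP (i + j) r; first exact: vf.
by rewrite (iter_eq0 v0 h) om0l; case: eqP => // E; move: h; rewrite -E ltnn.
Qed.

(* The normal form of type [((r, 1), 0)] with [v] moved into the long chain, so
   that the plane spanned by [z] and [w] is orthogonal to everything else. *)
Definition normal_frame r v f z w : Prop :=
  [/\ chain_pair r v f, x z = 0 /\ x w = 0, om z w = 1,
      om v z = 0 /\ om v w = 0 & om f z = 0 /\ om f w = 0].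

Definition boxes (mu nu : seq nat) :=
  [seq (i, j) | i <- iota 0 (maxn (size mu) (size nu)),
                j <- iota 1 (nth 0 mu i + nth 0 nu i)%N].

(** The basis condition of an exotic type comes for free: the pairings make the vectors independent,
    and their number is the dimension. *)
Lemma eType_intro v mu nu (b bs : nat -> nat -> V) :
  is_partition mu -> is_partition nu ->
  \dim {:V} = (size (boxes mu nu)).*2 ->
  {in boxes mu nu &, forall c d,
    [/\ om (b c.1 c.2) (bs d.1 d.2) = (c == d)%:R,
        om (b c.1 c.2) (b d.1 d.2) = 0 &
        om (bs c.1 c.2) (bs d.1 d.2) = 0]} ->
  v = \sum_(i < size mu) b i (nth 0%N mu i) ->
  {in boxes mu nu, forall c,
    x (b c.1 c.2) = if c.2 == 1%N then 0 else b c.1 c.2.-1} ->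
  {in boxes mu nu, forall c, x (bs c.1 c.2) =
    if c.2 == (nth 0 mu c.1 + nth 0 nu c.1)%N then 0 else bs c.1 c.2.+1} ->
  eType om v x (mu, nu).
Proof.
move=> hmu hnu hd horth hv hb hbs; split => //; exists b, bs; split => //.
rewrite -/(boxes mu nu); set B := boxes mu nu in hd horth *.
have Bu : uniq B.
  apply: allpairs_uniq_dep => [|i _|[i j] [i' j'] _ _ /= [-> ->]] //;
    exact: iota_uniq.
pose s := [seq b c.1 c.2 | c <- B] ++ [seq bs c.1 c.2 | c <- B].
(* [t] lists the partners of the vectors of [s]: the two halves are exchanged. *)
pose t k := let c := nth (0, 0)%N B k in let c' := nth (0, 0)%N B (k - size B)%N in
  if (k < size B)%N then bs c.1 c.2 else b c'.1 c'.2.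
have sz : size s = (size B + size B)%N by rewrite size_cat !size_map.
have sE k : (k < size s)%N ->
    s`_k = let c := nth (0, 0)%N B k in
           let c' := nth (0, 0)%N B (k - size B)%N in
      if (k < size B)%N then b c.1 c.2 else bs c'.1 c'.2.
  rewrite sz => hk; rewrite nth_cat size_map.
  case: ltnP => h; rewrite (nth_map (0, 0)%N) //; lia.
rewrite basisEfree subvf sz hd addnn leqnn !andbT.
apply: (@dual_free s t) => [i j hi hj ij|i hi]; rewrite sE // /t /=;
  move: (hi); rewrite sz => hi'.
  move: hj; rewrite sz => hj'.
  case: ltnP => h1; case: ltnP => h2.
  - have [-> _ _] := horth _ _ (mem_nth (0, 0)%N h1) (mem_nth (0, 0)%N h2).
    by rewrite nth_uniq // (negbTE ij).
  - have h2' : (j - size B < size B)%N by lia.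
    by have [_ ->] := horth _ _ (mem_nth (0, 0)%N h1) (mem_nth (0, 0)%N h2').
  - have h1' : (i - size B < size B)%N by lia.
    by have [_ _ ->] := horth _ _ (mem_nth (0, 0)%N h1') (mem_nth (0, 0)%N h2).
  - have h1' : (i - size B < size B)%N by lia.
    have h2' : (j - size B < size B)%N by lia.
    rewrite omC; have [-> _ _] :=
      horth _ _ (mem_nth (0, 0)%N h2') (mem_nth (0, 0)%N h1').
    by rewrite nth_uniq //; case: eqP => [E|]; [move: ij; lia | rewrite oppr0].
case: ltnP => h.
  have [-> _ _] := horth _ _ (mem_nth (0, 0)%N h) (mem_nth (0, 0)%N h).
  by rewrite eqxx oner_eq0.
have h' : (i - size B < size B)%N by lia.
rewrite omC;
  have [-> _ _] := horth _ _ (mem_nth (0, 0)%N h') (mem_nth (0, 0)%N h').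
by rewrite eqxx oppr_eq0 oner_eq0.
Qed.

Lemma boxes_row1 r : boxes [:: r] [::] = [seq (0, j) | j <- iota 1 r]%N.
Proof. by rewrite /boxes /= addn0 cats0. Qed.

Lemma boxes_row2 r :
  boxes [:: r; 1%N] [::] = rcons [seq (0, j) | j <- iota 1 r]%N (1, 1)%N.
Proof. by rewrite /boxes /= addn0 cats1. Qed.

Lemma mem_row1 r i k :
  (i, k) \in [seq (0, j) | j <- iota 1 r]%N -> i = 0%N /\ (0 < k <= r)%N.
Proof. by case/mapP => j; rewrite mem_iota add1n ltnS => h [-> ->]. Qed.

Lemma normal_frame_orth r v f z w j : normal_frame r v f z w ->
  [/\ om (iter j x v) z = 0, om (iter j x v) w = 0,
      om (iter j x f) z = 0 & om (iter j x f) w = 0].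
Proof.
move=> [_ [xz xw] _ [vz vw] [fz fw]].
case: j => // j; rewrite !iter_adj !iterSr xz xw iter0 !om0r; by split.
Qed.

Lemma eType_row2_inv r v : (0 < r)%N -> eType om v x ([:: r; 1%N], [::]) ->
  \dim {:V} = r.+1.*2 /\ exists f z w, normal_frame r v f z w.
Proof.
move=> r0 [_ _ [b [bs []]]]; rewrite -/(boxes [:: r;
  1%N] [::]) => hbasis horth hv hb hbs.
split.
  have := @vector.size_basis _ _ _ _ (in_tuple _) hbasis;
    rewrite (boxes_row2 r) size_cat !size_map size_rcons.
  by rewrite size_map size_iota addnn.
have B0 j : (0 < j <= r)%N -> (0, j)%N \in boxes [:: r; 1%N] [::].
  move=> hj; rewrite boxes_row2 mem_rcons in_cons; apply/orP; right.
  by apply/mapP; exists j; rewrite // mem_iota add1n ltnS.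
have B1 : (1, 1)%N \in boxes [:: r; 1%N] [::].
  by rewrite boxes_row2 mem_rcons mem_head.
have Br : (0, r)%N \in boxes [:: r; 1%N] [::] by apply: B0; rewrite r0 leqnn.
have B01 : (0, 1)%N \in boxes [:: r; 1%N] [::] by apply: B0.
have {}hv : v = b 0%N r + b 1%N 1%N.
  by rewrite hv /= big_ord_recl big_ord1.
have hbi j : (j < r)%N -> iter j x (b 0%N r) = b 0%N (r - j)%N.
  elim: j => [|j IH] h; first by rewrite subn0.
  rewrite iterS IH ?(ltnW h) // (hb (0, r - j)%N) /=; last by apply: B0; lia.
  by case: eqP => ?; [lia | congr (b _ _); lia].
have hbr : iter r x (b 0%N r) = 0.
  rewrite -{1}(prednK r0) iterS hbi ?prednK // (hb (0, r - r.-1)%N) /=.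
    by case: eqP => //; lia.
  by apply: B0; lia.
have hsi j : (j < r)%N -> iter j x (bs 0%N 1%N) = bs 0%N j.+1.
  elim: j => [|j IH] h //.
  rewrite iterS IH ?(ltnW h) // (hbs (0, j.+1)%N) /=; last by apply: B0; lia.
  by case: eqP => // ?; lia.
have hsr : iter r x (bs 0%N 1%N) = 0.
  rewrite -{1}(prednK r0) iterS hsi ?prednK // (hbs (0, r)%N) //=.
  by rewrite addn0 eqxx.
have xz : x (b 1 1)%N = 0 by rewrite (hb (1, 1)%N).
have xbs : x (bs 1 1)%N = 0 by rewrite (hbs (1, 1)%N).
(* Here [v] is [b 0 r + b 1 1], which pairs to 1 with both [bs 1 1] and [bs 0 r]. Their difference
   is thus orthogonal to [v], and [x] kills it because both vectors end their rows. *)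
exists (bs 0 1)%N, (b 1 1)%N, (bs 1%N 1%N - bs 0%N r); split.
- split => //.
    rewrite hv -[b 0%N r]scale1r iter_lin hbr scaler0 add0r.
    by rewrite -(prednK r0) iterSr xz iter0.
  move=> j hj; rewrite hv -[b 0%N r]scale1r iter_lin hbi // scale1r omDl.
  have Bj : (0, r - j)%N \in boxes [:: r; 1%N] [::] by apply: B0; lia.
  have [/= -> _ _] := horth _ _ Bj B01.
  have -> : om (iter j x (b 1 1)%N) (bs 0 1)%N = 0.
    case: j {hj Bj} => [|j]; last by rewrite iterSr xz iter0 om0l.
    by have [/= ->] := horth _ _ B1 B01.
  by rewrite addr0 xpair_eqE eqxx /=; congr (_%:R); congr nat_of_bool; lia.
- by rewrite linearB /= xbs (hbs (0, r)%N) //= addn0 eqxx subrr.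
- rewrite !omE; have [/= -> _ _] := horth _ _ B1 B1.
  by have [/= -> _ _] := horth _ _ B1 Br; rewrite subr0.
- rewrite hv !omE.
  have [/= -> -> _] := horth _ _ Br B1; have [/= -> _ _] := horth _ _ B1 B1.
  have [/= -> _ _] := horth _ _ Br Br; have [/= -> _ _] := horth _ _ B1 Br.
  by rewrite !eqxx; split; [ring | rewrite /=; ring].
- rewrite !omE omC; have [/= -> _ _] := horth _ _ B1 B01.
  have [/= _ _ ->] := horth _ _ B01 B1; have [/= _ _ ->] := horth _ _ B01 Br.
  by rewrite /= oppr0 addr0; split; rewrite ?oppr0 ?addr0.
Qed.

(** This power of [x] brings [v], the last vector of the row, to the first one, which pairs to 1
    with its dual. *)
Lemma eType_row1_inv r v : (0 < r)%N -> eType om v x ([:: r], [::]) ->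
  iter r.-1 x v != 0.
Proof.
move=> r0 [_ _ [b [bs []]]]; rewrite -/(boxes [:: r] [::]) => _ horth hv hb _.
have B0 j : (0 < j <= r)%N -> (0, j)%N \in boxes [:: r] [::].
  by move=> hj; rewrite boxes_row1; apply/mapP; exists j;
    rewrite // mem_iota add1n ltnS.
have hbi j : (j < r)%N -> iter j x v = b 0%N (r - j)%N.
  elim: j => [|j IH] h; first by rewrite subn0 hv big_ord1.
  rewrite iterS IH ?(ltnW h) // (hb (0, r - j)%N) /=; last by apply: B0; lia.
  by case: eqP => ?; [lia | congr (b _ _); lia].
have B01 : (0, 1)%N \in boxes [:: r] [::] by apply: B0.
rewrite hbi; last by rewrite prednK.
have -> : (r - r.-1 = 1)%N by lia.
have [/= h _ _] := horth _ _ B01 B01.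
by apply: contra_eq_neq h => ->; rewrite om0l eq_sym oner_eq0.
Qed.

Hypothesis K2 : (2%:R : K) != 0.

(** With all powers of [x] on one side, adjointness and antisymmetry make the value equal to its own
    opposite. *)
Lemma iter_isotropic i j a : om (iter i x a) (iter j x a) = 0.
Proof.
rewrite iter_adj -iterD; apply/eqP; have /eqP : om a (iter (i + j) x a) =
  - om a (iter (i + j) x a) by rewrite {1}omC iter_adj.
by rewrite -addr_eq0 -mulr2n -mulr_natr mulf_eq0 (negbTE K2) orbF.
Qed.

(** The filter turns a chain of length 0 into the empty partition, in the way [shape_le] drops empty
    rows. *)
Lemma eType_chain r v f : \dim {:V} = r.*2 ->
  chain_pair r v f ->
  eType om v x ([seq k <- [:: r] | (0 < k)%N], [::]).
Proof.
move=> hd cp; have [v0 f0 vf] := cp.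
case: r hd cp v0 f0 vf => [|r] hd cp v0 f0 vf.
  apply: (@eType_intro _ _ _ (fun _ _ => 0) (fun _ _ => 0)) => //=.
  have : v \in {:V}%VS by rewrite memvf.
  have /eqP := hd; rewrite dimv_eq0 => /eqP ->; rewrite memv0 => /eqP ->.
  by rewrite big_ord0.
rewrite /=; apply: (@eType_intro _ _ _ (fun _ j => iter (r.+1 - j) x v)
  (fun _ j => iter j.-1 x f)) => //.
- by rewrite boxes_row1 size_map size_iota.
- rewrite boxes_row1 => -[c1 c] [d1 d] /mem_row1[-> hc] /mem_row1[-> hd'].
  split; rewrite ?iter_isotropic // (chain_pairE _ _ cp).
  by congr (_%:R); congr nat_of_bool; rewrite xpair_eqE eqxx /=; lia.
- by rewrite big_ord1 subnn.
- rewrite boxes_row1 => -[c1 c] /mem_row1[-> hc].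
  rewrite /= -iterS; case: eqP => [->|h]; first by rewrite subSS subn0.
  by congr (iter _ x _); lia.
- rewrite boxes_row1 => -[c1 c] /mem_row1[-> hc].
  rewrite /= -iterS addn0; case: eqP => [->//|h].
  by congr (iter _ x _); lia.
Qed.

Lemma eType_normal r v f z w : (0 < r)%N -> \dim {:V} = r.+1.*2 ->
  normal_frame r v f z w -> eType om v x ([:: r; 1%N], [::]).
Proof.
move=> r0 hd nf; have [cp [xz xw] zw [vz vw] [fz fw]] := nf.
have [v0 f0 vf] := cp.
have o j := normal_frame_orth j nf.
have zv j : om z (iter j x v) = 0 by apply: om_eq0C; case: (o j).
have wv j : om w (iter j x v) = 0 by apply: om_eq0C; case: (o j).
have zf j : om z (iter j x f) = 0 by apply: om_eq0C; case: (o j).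
have wf j : om w (iter j x f) = 0 by apply: om_eq0C; case: (o j).
have vz' j : om (iter j x v) z = 0 by case: (o j).
have vw' j : om (iter j x v) w = 0 by case: (o j).
have fz' j : om (iter j x f) z = 0 by case: (o j).
have fw' j : om (iter j x f) w = 0 by case: (o j).
have zz : om z z = 0 by rewrite alt.
have wz : om w z = - 1 by rewrite omC zw.
have fv i j : om (iter i x f) (iter j x v) = - ((j + i).+1 == r)%:R.
  by rewrite omC (chain_pairE _ _ cp).
(* This inverts the change of basis of [eType_row2_inv]: [z] is taken off the end of the long row,
   so that [v] is again a sum over both rows, and [w] receives the compensating term [x^(r-1) f]. *)
pose b (i j : nat) : V := if i == 0%N then
  iter (r - j) x v - (j == r)%:R *: z else z.
pose bs (i j : nat) : V := if i == 0%N then iter j.-1 x f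
  else w + iter r.-1 x f.
apply: (@eType_intro _ _ _ b bs) => //.
- by rewrite /is_partition /= andbT r0; case: (r) r0.
- by rewrite boxes_row2 size_rcons size_map size_iota.
- rewrite boxes_row2 => -[c1 c] [d1 d]; rewrite !mem_rcons !in_cons.
  move=> /orP[/eqP[-> ->]|/mem_row1[-> hc]]
         /orP[/eqP[-> ->]|/mem_row1[-> hd']]; rewrite /b /bs /=;
  rewrite !omE ?zv ?zf ?vz' ?vw' ?wf ?fw' ?iter_isotropic ?zw
    ?(chain_pairE _ _ cp) ?xpair_eqE ?mulr0 ?subr0 ?addr0 ?add0r ?zz ?wz ?fz'
    ?oppr0 ?eqxx /=; split=> //.
  + rewrite mulr1; have -> : ((r - c + r.-1).+1 == r) = (c == r) by lia.
    by rewrite subrr.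
  + by congr (_%:R); congr nat_of_bool; lia.
- rewrite /= big_ord_recl big_ord1 /b /= subnn eqxx scale1r subrK //.
- rewrite boxes_row2 => -[c1 c]; rewrite mem_rcons in_cons.
  move=> /orP[/eqP[-> ->]|/mem_row1[-> hc]]; rewrite /b /= ?xz //.
  rewrite linearB linearZ /= xz scaler0 subr0 -iterS.
  case: eqP => [->|h]; first by rewrite subn1 prednK.
  have -> : (c.-1 == r) = false by lia.
  by rewrite scale0r subr0; congr (iter _ x _); lia.
- rewrite boxes_row2 => -[c1 c]; rewrite mem_rcons in_cons.
  move=> /orP[/eqP[-> ->]|/mem_row1[-> hc]]; rewrite /bs /=.
    by rewrite linearD /= xw add0r -iterS prednK.
  by rewrite -iterS addn0 (ltn_predK (m := 0)); [case: eqP => [->|] | lia].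
Qed.

End AlternatingForms.

(** * Passing to the quotient of the perpendicular space of F by F *)

Section Reduction.
Variables (K : fieldType) (V : vectType K) (om : V -> V -> K).
Hypothesis om_form : alternating_form om.

Let linl : forall c, linear (om^~ c : V -> K^o). Proof. by case: om_form. Qed.
Let linr : forall c, linear (om c : V -> K^o). Proof. by case: om_form. Qed.

Lemma memv_perp (F : {vspace V}) a :
  (a \in perp om F) <-> (forall b, b \in F -> om b a = 0).
Proof. by split => /(perpP linl linr). Qed.

Variables (x : 'End(V)) (F : {vspace V}).
Hypothesis x_adj : forall a b, om (x a) b = om a (x b).
Hypothesis F_iso : (F <= perp om F)%VS.
Hypothesis xF : (x @: F <= F)%VS.

Local Notation qform := (@quo_form _ _ om F).
Local Notation qend := (quo_end om F x).

Lemma perp_stable : (x @: perp om F <= perp om F)%VS.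
Proof.
apply/subvP => _ /memv_imgP[a aF ->]; apply/memv_perp => b bF.
by rewrite -x_adj; apply: (memv_perp _ _).1 aF _ _;
  rewrite (subvP xF) ?memv_img.
Qed.

Lemma vsval_perp (a : perp_quo om F) : vsval a \in perp om F.
Proof. exact: (subvP (diffvSl _ _) _ (subvsP _)). Qed.

Lemma quo_form_alternating : alternating_form qform.
Proof.
rewrite /quo_form; split => [c|c|a].
- by move=> k u w; rewrite linearP; apply: linl.
- by move=> k u w; rewrite linearP; apply: linr.
- by case: om_form.
Qed.

Lemma quo_form_to a b : a \in perp om F -> b \in perp om F ->
  qform (to_quo om F a) (to_quo om F b) = om a b.
Proof. by apply: quo_formE => //; apply: omC. Qed.

Lemma quo_end_to a : a \in perp om F ->
  qend (to_quo om F a) = to_quo om F (x a).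
Proof. by apply: quo_endE => //; apply: perp_stable. Qed.

Lemma quo_end_adj a b : qform (qend a) b = qform a (qend b).
Proof.
rewrite -(to_quo_val a) -(to_quo_val b) !quo_end_to ?vsval_perp //.
by rewrite !quo_form_to ?x_adj ?vsval_perp // (subvP perp_stable) // memv_img // vsval_perp.
Qed.

Lemma iter_perp j a : a \in perp om F -> iter j x a \in perp om F.
Proof.
by move=> aF; elim: j => //= j IH; rewrite (subvP perp_stable) ?memv_img.
Qed.

Lemma iter_quo_end j a : a \in perp om F ->
  iter j qend (to_quo om F a) = to_quo om F (iter j x a).
Proof. by move=> aF; elim: j => //= j ->; rewrite quo_end_to ?iter_perp. Qed.

(** Exotic types of quotients constrain a flag through this test, which turns nilpotency exponents
    into membership in [F]. *)
Lemma iter_quo_end_eq0 j a : a \in perp om F ->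
  (iter j qend (to_quo om F a) == 0) = (iter j x a \in F).
Proof. by move=> aF; rewrite iter_quo_end // to_quo_eq0 ?iter_perp. Qed.

Lemma dim_perp_quo : \dim {: perp_quo om F} = (\dim (perp om F) - \dim F)%N.
Proof.
rewrite dimvf /=; have := dimv_cap_compl (perp om F) F.
by rewrite (capv_idPr F_iso) => <-; rewrite addKn.
Qed.

Lemma chain_pair_quo r v f : v \in perp om F -> f \in perp om F ->
  iter r x v \in F -> iter r x f \in F ->
  (forall j, (j < r)%N -> om (iter j x v) f = (j.+1 == r)%:R) ->
  chain_pair qform qend r (to_quo om F v) (to_quo om F f).
Proof.
move=> vF fF vr fr vf; split.
- by apply/eqP; rewrite iter_quo_end_eq0.
- by apply/eqP; rewrite iter_quo_end_eq0.
- by move=> j jr; rewrite iter_quo_end // quo_form_to ?vf ?iter_perp.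
Qed.

Lemma normal_frame_quo r v f z w : v \in perp om F -> f \in perp om F ->
  z \in perp om F -> w \in perp om F ->
  iter r x v \in F -> iter r x f \in F ->
  (forall j, (j < r)%N -> om (iter j x v) f = (j.+1 == r)%:R) ->
  x z = 0 -> x w = 0 -> om z w = 1 -> om v z = 0 -> om v w = 0 ->
  om f z = 0 -> om f w = 0 ->
  normal_frame qform qend r (to_quo om F v) (to_quo om F f)
    (to_quo om F z) (to_quo om F w).
Proof.
move=> vF fF zF wF vr fr vf xz xw zw vz vw fz fw; split.
- exact: chain_pair_quo.
- by rewrite !quo_end_to // xz xw /to_quo !linear0.
- by rewrite quo_form_to.
- by rewrite !quo_form_to.
- by rewrite !quo_form_to.
Qed.

End Reduction.

(** * Flags in the exotic Springer fibre *)

Section FlagsOfFrames.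
Variables (K : fieldType) (V : vectType K) (m : nat).
Implicit Types (e : {ffun 'I_m -> V}) (G : {vspace V}).

Local Notation flagof e := (@pt _ (flags V m) e).

Lemma flagofE e (k : 'I_m.+1) :
  flagof e k = (\sum_(j < m | (j < k)%N) <[e j]>)%VS.
Proof. by rewrite ffunE. Qed.

Lemma mem_flagof e (j : 'I_m) (k : 'I_m.+1) : (j < k)%N -> e j \in flagof e k.
Proof. by move=> jk; rewrite flagofE memvE (sumv_sup j). Qed.

Lemma flagof_subP e (k : 'I_m.+1) G :
  (flagof e k <= G)%VS <-> (forall j : 'I_m, (j < k)%N -> e j \in G).
Proof.
rewrite flagofE; split => [/subv_sumP h j /h|h]; first by rewrite memvE.
by apply/subv_sumP => j /h; rewrite memvE.
Qed.

Lemma flagof_mono e (j k : 'I_m.+1) : (j <= k)%N ->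
  (flagof e j <= flagof e k)%VS.
Proof.
by move=> jk; apply/flagof_subP => i ij; apply/mem_flagof/(leq_trans ij).
Qed.

Lemma flagof_span e (k : 'I_m.+1) : flagof e k = <<take k (codom e)>>%VS.
Proof.
have sz : size (take k (codom e)) = k.
  by rewrite size_takel // size_codom card_ord -ltnS.
apply/eqP; rewrite eqEsubv; apply/andP; split.
  apply/flagof_subP => j jk; apply/memv_span.
  have -> : e j = (take k (codom e))`_j.
    rewrite nth_take // (nth_map j) ?size_enum_ord //; congr (e _);
      apply/val_inj.
    by rewrite /= nth_enum_ord.
  by rewrite mem_nth ?sz.
apply/span_subvP => y /(nthP 0)[j]; rewrite sz => jk <- {y}.
have jm : (j < m)%N by apply: leq_trans jk _; rewrite -ltnS.
rewrite nth_take // (nth_map (Ordinal jm)) ?size_enum_ord //.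
by apply: mem_flagof; rewrite nth_enum_ord.
Qed.

Lemma dim_flagof e (k : 'I_m.+1) : basis_of {:V} (codom e) ->
  \dim (flagof e k) = k.
Proof.
move=> /basis_free hf; rewrite flagof_span.
have : free (take k (codom e)).
  by apply: (catl_free (Y := drop k (codom e))); rewrite cat_take_drop.
by move/eqnP ->; rewrite size_takel // size_codom card_ord -ltnS.
Qed.

End FlagsOfFrames.

Section ExoticFibre.
Variables (K : fieldType) (V : vectType K) (om : V -> V -> K).
Hypothesis om_form : alternating_form om.
Variables (n : nat) (v : V) (x : 'End(V)).
Hypothesis x_adj : forall a b, om (x a) b = om a (x b).

Local Notation flag := {ffun 'I_(n.*2).+1 -> {vspace V}}.
Local Notation flagof e := (@pt _ (flags V n.*2) e).

(* [springer_fibre] for an arbitrary space with an alternating form *)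
Definition exotic_fibre : set flag :=
  [set F : flag |
    [/\ (forall k, \dim (F k) = k),
        (forall j k : 'I_(n.*2).+1, (j <= k)%N -> (F j <= F k)%VS),
        (forall k, perp om (F k) = F (rev_ord k)),
        v \in F (inord n) &
        forall j k : 'I_(n.*2).+1, k = j.+1 :> nat -> (x @: F k <= F j)%VS]].

Lemma mem_perp_flagof (e : {ffun 'I_n.*2 -> V}) (k : 'I_(n.*2).+1) b :
  (forall j : 'I_n.*2, (j < k)%N -> om (e j) b = 0) ->
    b \in perp om (flagof e k).
Proof.
move=> hb; apply/(memv_perp om_form) => a.
suff : (flagof e k <= perp om <[b]>)%VS.
  move=> /subvP h /h /(memv_perp om_form) ha; apply: om_eq0C => //.
  by apply: ha; apply: memv_line.
apply/flagof_subP => j jk; apply/(memv_perp om_form) => _ /vlineP[l ->].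
by rewrite (omZl om_form) (om_eq0C om_form) ?mulr0 ?hb.
Qed.

Section Pairing.
Variable c : {ffun 'I_n.*2 -> V}.
Hypothesis c_pair : forall i j, (om (c i) (c j) == 0) = (j != rev_ord i).
Hypothesis dimV : \dim {:V} = n.*2.

Lemma frame_basis : basis_of {:V} (codom c).
Proof.
have sz : size (codom c) = n.*2 by rewrite size_codom card_ord.
have cE k (i : 'I_n.*2) : k = i :> nat -> (codom c)`_k = c i.
  move=> ->; rewrite (nth_map i) ?size_enum_ord //; congr (c _); apply/val_inj.
  by rewrite /= nth_enum_ord.
rewrite basisEfree subvf dimV sz leqnn !andbT.
apply: (dual_free om_form (d := fun k => (codom c)`_(n.*2 - k.+1))).
  move=> i j; rewrite sz => hi hj ij.
  have hj' : (n.*2 - j.+1 < n.*2)%N by lia.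
  rewrite (cE i (Ordinal hi)) // (cE _ (Ordinal hj')) //; apply/eqP.
  by rewrite c_pair -val_eqE /=; lia.
move=> i; rewrite sz => hi; rewrite (cE i (Ordinal hi)) //.
by rewrite (cE _ (rev_ord (Ordinal hi))) // c_pair eqxx.
Qed.

(** The Gram matrix is antidiagonal, so pairing with the mirror vector reads off a single
    coordinate: orthogonality to the first [k] vectors kills the last [k] coordinates. *)
Lemma frame_perp k : perp om (flagof c k) = flagof c (rev_ord k).
Proof.
apply/eqP; rewrite eqEsubv; apply/andP; split; last first.
  apply/flagof_subP => j hj; apply: mem_perp_flagof => i ik.
  by apply/eqP; rewrite c_pair -val_eqE /=; move: hj => /=; lia.
apply/subvP => y /(memv_perp om_form) hy.
have ytup := coord_span (X := codom_tuple c).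
have yc : y \in <<codom_tuple c>>%VS.
  by case/andP: frame_basis => /eqP -> _; apply: memvf.
have {ytup}hd : y = \sum_(i < #|'I_n.*2|) coord (codom_tuple c) i y *: c (enum_val i).
  rewrite {1}(coord_span yc); apply: eq_bigr => i _; congr (_ *: _).
  rewrite (nth_map (enum_val i)) -?cardE //; congr (c _).
  by rewrite -enum_val_nth.
rewrite hd; apply: memv_suml => i _.
have [h|h] := ltnP (enum_val i) (rev_ord k).
  by rewrite memvZ // mem_flagof.
suff -> : coord (codom_tuple c) i y = 0 by rewrite scale0r mem0v.
have : om (c (rev_ord (enum_val i))) y = 0.
  by apply: hy; apply: mem_flagof; move: h (valP (enum_val i)) => /=; lia.
rewrite hd (om_sumr om_form) (bigD1 i) //= big1 => [|j ji].
  rewrite addr0 (omZr om_form) => /eqP;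
    rewrite mulf_eq0 c_pair rev_ordK eqxx orbF.
  by rewrite -hd => /eqP.
rewrite (omZr om_form); apply/eqP; rewrite mulf_eq0 c_pair rev_ordK.
by rewrite (inj_eq enum_val_inj) ji orbT.
Qed.

(** Dimensions force equality up to the middle, and the upper half consists of the perpendicular
    spaces of the lower half. *)
Lemma fibre_eq_frame F : exotic_fibre F ->
  (forall (j : 'I_n.*2) (k : 'I_(n.*2).+1), (j < k)%N -> (k <= n)%N ->
    c j \in F k) ->
  F = flagof c.
Proof.
move=> [Fdim _ Fperp _ _] h.
have half (k : 'I_(n.*2).+1) : (k <= n)%N -> F k = flagof c k.
  move=> kn; apply/esym/eqP; rewrite eqEdim Fdim dim_flagof ?leqnn ?andbT //.
    by apply/flagof_subP => j jk; apply: h.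
  exact: frame_basis.
apply/ffunP => k; have [/half//|kn] := leqP k n.
rewrite -(rev_ordK k) -Fperp -frame_perp half //=; lia.
Qed.

(* Self-adjointness transfers the condition on [x] from the isotropic half. *)
Lemma frame_fibre : v \in flagof c (inord n) ->
  (forall (j : 'I_n.*2) (k : 'I_(n.*2).+1), (j < n)%N -> k = j :> nat ->
     x (c j) \in flagof c k) ->
  exotic_fibre (flagof c).
Proof.
move=> hv hx; split => //.
- by move=> k; apply: dim_flagof; apply: frame_basis.
- by move=> j k; apply: flagof_mono.
- exact: frame_perp.
have half (j k : 'I_(n.*2).+1) : k = j.+1 :> nat -> (k <= n)%N ->
    (x @: flagof c k <= flagof c j)%VS.
  move=> kj kn; apply/subvP => _ /memv_imgP[y yk ->].
  rewrite memv_preim; move: y yk; apply/subvP; apply/flagof_subP => i ik.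
  rewrite -memv_preim.
  have hi : (i < (n.*2).+1)%N by rewrite ltnS ltnW.
  apply: (subvP (flagof_mono c (j := Ordinal hi) _)); first by move=> /=; lia.
  by apply: hx => //; lia.
move=> j k kj; have [/half|kn] := leqP k n; first exact.
apply/subvP => _ /memv_imgP[y yk ->].
rewrite -(rev_ordK j) -frame_perp; apply/memv_perp => // b bj.
rewrite -x_adj; move: yk; rewrite -(rev_ordK k) -frame_perp.
move=> /(memv_perp om_form); apply.
apply: (subvP (half _ (rev_ord j) _ _)); last by apply: memv_img.
- by move=> /=; move: (ltn_ord k); lia.
- by move=> /=; lia.
Qed.

End Pairing.

Section FibreTheory.
Variable F : flag.
Hypothesis hF : exotic_fibre F.

(** Each application of [x] goes down one step of the flag; at step 0 the vector is 0, so [j] may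
    exceed [k]. *)
Lemma fibre_iter j k l a : a \in F (inord k) -> (k <= n.*2)%N ->
  (k <= l + j)%N -> (l <= n.*2)%N -> iter j x a \in F (inord l).
Proof.
have [_ Fmono _ _ Fx] := hF.
elim: j k l a => [|j IH] k l a ak kn kl ln.
  by apply: (subvP (Fmono (inord k) (inord l) _)) => //; rewrite !inordK; lia.
rewrite iterSr; case: k ak kn kl => [|k] ak kn kl.
  apply: (IH 0%N) => //.
  have [Fdim _ _ _ _] := hF.
  have : \dim (F (inord 0)) = 0%N by rewrite Fdim inordK.
  by move/eqP; rewrite dimv_eq0 => /eqP E; move: ak;
    rewrite E !memv0 => /eqP ->; rewrite linear0.
apply: (IH k); rewrite ?(ltnW kn) //; last by lia.
apply: (subvP (Fx (inord k) (inord k.+1) _)); last exact: memv_img.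
by rewrite !inordK; lia.
Qed.

Lemma fibre_vn j : (j <= n)%N -> iter j x v \in F (inord (n - j)).
Proof.
by move=> jn; apply: (fibre_iter (k := n)); [case: hF | lia | lia | lia].
Qed.

Lemma fibre_mono j k a : (j <= k <= n.*2)%N -> a \in F (inord j) ->
  a \in F (inord k).
Proof.
move=> jk; have [_ Fmono _ _ _] := hF.
by apply: (subvP (Fmono (inord j) (inord k) _)); rewrite !inordK; lia.
Qed.

Lemma fibre_dim k : (k <= n.*2)%N -> \dim (F (inord k)) = k.
Proof. by move=> kn; have [-> _ _ _ _] := hF; rewrite inordK. Qed.

Lemma fibre_perp k : (k <= n.*2)%N ->
  perp om (F (inord k)) = F (inord (n.*2 - k)).
Proof.
move=> kn; have [_ _ -> _ _] := hF; congr (F _); apply/val_inj.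
by rewrite /= !inordK; lia.
Qed.

Lemma fibre_om j k a b : a \in F (inord j) -> b \in F (inord k) ->
  (j + k <= n.*2)%N -> om a b = 0.
Proof.
move=> aj bk jk; have jn : (j <= n.*2)%N by lia.
have : b \in perp om (F (inord j)).
  by rewrite fibre_perp //; apply: fibre_mono bk; lia.
by move/(memv_perp om_form); apply.
Qed.

End FibreTheory.

End ExoticFibre.

(** * The component *)

Lemma bishape_T n k i : (2 <= i <= n)%N -> (k <= n)%N -> bishape_le k (T_ n i) =
  if (k < i)%N then ([seq l <- [:: k] | (0 < l)%N], [::])
  else ([:: k.-1; 1%N], [::]).
Proof.
move=> /andP[i2 iN] kn; rewrite /bishape_le /shape_le /T_ /=.
have cnt : count (fun e => (e <= k)%N) [seq j <- iota 1 n | j != i] =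
    (k - (i <= k)%N)%N.
  have ck l : count (fun e => (e <= k)%N) (iota 1 l) = minn k l.
    elim: l => [|l IH]; first by rewrite minn0.
    by rewrite -[l.+1]addn1 iotaD count_cat IH /= addn0; lia.
  have e : (count (fun e => (e <= k)%N) [seq j <- iota 1 n | j != i] +
      count (fun e => (e <= k)%N) [seq j <- iota 1 n | ~~ (j != i)] = minn k n)%N.
    rewrite -ck -count_cat; apply/permP; exact: (permEl (perm_filterC _ _)).
  have e' : [seq j <- iota 1 n | ~~ (j != i)] = [:: i].
    rewrite (eq_filter (a2 := pred1 i)) => [|j]; last by rewrite /= negbK.
    by rewrite filter_pred1_uniq ?iota_uniq // mem_iota; clear -i2 iN; lia.
  by move: e; rewrite e' /= addn0; clear -kn; lia.
rewrite cnt addn0; case: (leqP i k) => ki /=; last by rewrite subn0.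
have -> : (0 < k - 1)%N by clear -ki i2; lia.
by rewrite subn1.
Qed.

(** * Coordinates and charts for lines in the plane *)

Section PlaneVectors.
Variable K : fieldType.
Implicit Types s t g y : 'rV[K]_2.

Definition vec2 (a b : K) : 'rV[K]_2 := \row_j (if j == 0 then a else b).

Lemma vec2_0 a b : vec2 a b 0 0 = a. Proof. by rewrite mxE. Qed.
Lemma vec2_1 a b : vec2 a b 0 1 = b. Proof. by rewrite mxE. Qed.

Lemma vec2_eta s : s = vec2 (s 0 0) (s 0 1).
Proof.
apply/rowP => j; rewrite mxE; case: eqP => [->//|j0]; congr (s _ _).
by apply/val_inj; case: j j0 => -[|[|//]] h // /eqP.
Qed.

(** [g] plays the part of a linear form; the lines on which it does not vanish form an affine chart
    of P^1. *)
Definition dot g s : K := g 0 0 * s 0 0 + g 0 1 * s 0 1.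
Definition det2 t y : K := t 0 0 * y 0 1 - t 0 1 * y 0 0.

Lemma row2_neq0 s : (s != 0) = (s 0 0 != 0) || (s 0 1 != 0).
Proof.
rewrite -negb_and; congr (~~ _); apply/eqP/andP => [->|[/eqP h0 /eqP h1]].
  by rewrite !mxE eqxx.
by rewrite (vec2_eta s) h0 h1; apply/rowP => j; rewrite !mxE; case: ifP.
Qed.

Lemma exists_dot s : s != 0 -> exists g, dot g s != 0.
Proof.
rewrite row2_neq0 => /orP[h|h]; [exists (vec2 1 0) | exists (vec2 0 1)];
  by rewrite /dot vec2_0 vec2_1 mul1r mul0r ?addr0 ?add0r.
Qed.

Lemma exists_det2 t : t != 0 -> exists y, det2 t y != 0.
Proof.
rewrite row2_neq0 => /orP[h|h]; [exists (vec2 0 1) | exists (vec2 1 0)];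
  by rewrite /det2 vec2_0 vec2_1 !mulr1 !mulr0 ?subr0 ?sub0r ?oppr_eq0.
Qed.

Lemma dotZ g c s : dot g (c *: s) = c * dot g s.
Proof. by rewrite /dot !mxE; ring. Qed.

Lemma det2Z c t y : det2 (c *: t) y = c * det2 t y.
Proof. by rewrite /det2 !mxE; ring. Qed.

Lemma det2C t y : det2 t y = - det2 y t.
Proof. by rewrite /det2; ring. Qed.

Lemma det2_diag t : det2 t t = 0.
Proof. by rewrite /det2; ring. Qed.

Lemma det2_eq0 s t : s != 0 -> det2 s t = 0 -> exists c, t = c *: s.
Proof.
rewrite row2_neq0 /det2 => s0 /eqP; rewrite subr_eq0 => /eqP h.
have [h0|h0] := eqVneq (s 0 0) 0; last first.
  exists (t 0 0 / s 0 0); rewrite [LHS]vec2_eta [RHS]vec2_eta !mxE.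
  by congr vec2; [field | apply: (mulfI h0); rewrite h; field].
have h1 : s 0 1 != 0 by move: s0; rewrite h0 eqxx.
exists (t 0 1 / s 0 1); rewrite [LHS]vec2_eta [RHS]vec2_eta !mxE.
congr vec2; last by field.
by apply: (mulfI h1); rewrite -h h0; field.
Qed.

Lemma dot_neq0 g s : dot g s != 0 -> s != 0.
Proof. by apply: contraNneq => ->; rewrite /dot !mxE !mulr0 addr0. Qed.

Lemma eq_line s s' : s != 0 -> s' != 0 -> (<[s]> = <[s']>)%VS ->
  exists2 c, c != 0 & s' = c *: s.
Proof.
move=> s0 s'0 E; have : s' \in <[s]>%VS by rewrite E memv_line.
move=> /vlineP[c hc]; exists c => //; apply: contraNneq s'0 => c0.
by rewrite hc c0 scale0r.
Qed.

Lemma line_gen s a : a \in <[s]>%VS -> a != 0 -> (<[a]> = <[s]>)%VS.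
Proof.
move=> /vlineP[c ->]; rewrite scaler_eq0 negb_or => /andP[c0 s0].
apply/eqP; rewrite eqEsubv -!memvE memvZ ?memv_line //=.
by apply/vlineP; exists c^-1; rewrite scalerA mulVf // scale1r.
Qed.

End PlaneVectors.

Section Component.
Variables (K : fieldType) (V : vectType K) (om : V -> V -> K).
Hypothesis om_form : alternating_form om.
Variables (x : 'End(V)).
Hypothesis x_adj : forall a b, om (x a) b = om a (x b).
Hypothesis K2 : (2%:R : K) != 0.
Variables (p m n : nat) (v f z w : V).
Hypothesis np : n = p.+2.
Hypothesis mp : (m <= p)%N.
Hypothesis dimV : \dim {:V} = n.*2.
Hypothesis nf : normal_frame om x p.+1 v f z w.

Local Notation flagof e := (@pt _ (flags V n.*2) e).
Local Notation fibre := (@exotic_fibre _ _ om n v x).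

(** * Frames built from a pair of lines *)

Definition ee j := iter (p - j) x v.
Definition ff j := iter j x f.
Definition uu (s : 'rV[K]_2) := s 0 0 *: z + s 0 1 *: w.
(** The vector of the plane representing the form [dot g]: [om (uu s) (wg g)] is [dot g s]. *)
Definition wg (g : 'rV[K]_2) := g 0 0 *: w - g 0 1 *: z.

Lemma ee_ff i j : (i <= p)%N -> (j <= p)%N -> om (ee i) (ff j) = (i == j)%:R.
Proof.
move=> ip jp;
  rewrite (chain_pairE om_form x_adj _ _ (let: And5 h _ _ _ _ := nf in h)).
by congr (_%:R); congr nat_of_bool; lia.
Qed.

Lemma ff_ee i j : (i <= p)%N -> (j <= p)%N -> om (ff j) (ee i) = - (i == j)%:R.
Proof. by move=> ip jp; rewrite (omC om_form) ee_ff. Qed.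

Lemma ee_ee i j : om (ee i) (ee j) = 0.
Proof. exact: (iter_isotropic om_form x_adj). Qed.

Lemma ff_ff i j : om (ff i) (ff j) = 0.
Proof. exact: (iter_isotropic om_form x_adj). Qed.

Lemma ee_zw i : [/\ om (ee i) z = 0, om (ee i) w = 0, om z (ee i) = 0 & om w (ee i) = 0].
Proof.
have [h1 h2 _ _] := normal_frame_orth om_form x_adj (p - i) nf.
by split => //; apply: om_eq0C.
Qed.

Lemma ff_zw i : [/\ om (ff i) z = 0, om (ff i) w = 0, om z (ff i) = 0 & om w (ff i) = 0].
Proof.
have [_ _ h1 h2] := normal_frame_orth om_form x_adj i nf.
by split => //; apply: om_eq0C.
Qed.

Lemma om_zw : om z w = 1. Proof. by case: nf. Qed.
Lemma om_wz : om w z = -1. Proof. by rewrite (omC om_form) om_zw. Qed.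

Definition pairE i := (ee_ee, ff_ff,
  (let: And4 h _ _ _ := ee_zw i in h), (let: And4 _ h _ _ := ee_zw i in h),
  (let: And4 _ _ h _ := ee_zw i in h), (let: And4 _ _ _ h := ee_zw i in h),
  (let: And4 h _ _ _ := ff_zw i in h), (let: And4 _ h _ _ := ff_zw i in h),
  (let: And4 _ _ h _ := ff_zw i in h), (let: And4 _ _ _ h := ff_zw i in h),
  om_zw, om_wz).

Lemma x_ee j : (j <= p)%N -> x (ee j) = if j == 0%N then 0 else ee j.-1.
Proof.
move=> jp; rewrite -[x (ee j)]/(iter (p - j).+1 x v); case: eqP => [->|h].
  by rewrite subn0; case: nf => -[].
by congr (iter _ x _); lia.
Qed.

Lemma x_uu s : x (uu s) = 0.
Proof. by have [_ [xz xw] _ _ _] := nf;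
  rewrite linearD !linearZ /= xz xw !scaler0 addr0. Qed.

Lemma x_wg g : x (wg g) = 0.
Proof.
have [_ [xz xw] _ _ _] := nf.
by rewrite /wg linearB linearZ linearZ /= xz xw !scaler0 subrr.
Qed.

(* Dividing by [dot g s] would make [uu s] depend only on the line of [s]; the
   factor [dot g s] on [ee m] clears this denominator. *)
Definition mid (g s t : 'rV[K]_2) := (dot g s * t 0 0) *: ee m + t 0 1 *: uu s.
(** The signs are chosen so that the pairing with [mid] is [det2] times [dot g s]; in particular
    [comid g t] is orthogonal to [mid g s t]. *)
Definition comid (g t : 'rV[K]_2) := t 0 1 *: ff m - t 0 0 *: wg g.

Lemma x_comid g t : x (comid g t) = t 0 1 *: x (ff m).
Proof.
rewrite /comid; move: (wg g) (x_wg g) => u xu.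
by rewrite linearB linearZ linearZ /= xu scaler0 subr0.
Qed.

(** Positions [m] and [m.+1] hold a basis of <e_m, u> whose first vector gives the line of F_{m+1}.
    Together they replace [ee m] and one more vector, whence the shift of index beyond them. *)
Definition lo (g y s t : 'rV[K]_2) k :=
  if (k < m)%N then ee k else if k == m then mid g s t
  else if k == m.+1 then mid g s y else ee k.-1.

Definition hi (g y t : 'rV[K]_2) k :=
  if (k < m)%N then ff k else if k == m then comid g y
  else if k == m.+1 then comid g t else ff k.-1.

(* The second half lists the dual of the first in reverse order, so that the
   Gram matrix is antidiagonal; [g] and [y] select charts of the two projective
   lines. *)
Definition frame (g y : 'rV[K]_2) (st : 'rV[K]_2 * 'rV[K]_2) : {ffun 'I_n.*2 -> V} :=
  [ffun k : 'I_n.*2 => if (k < n)%N then lo g y st.1 st.2 k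
                       else hi g y st.2 (n.*2.-1 - k)].

Lemma lohiP g y s t k : (k < n)%N ->
  [\/ exists j, [/\ (j <= p)%N, j != m, j = (if (k <= m)%N then k else k.-1),
        lo g y s t k = ee j & hi g y t k = ff j],
      [/\ k = m, lo g y s t k = mid g s t & hi g y t k = comid g y] |
      [/\ k = m.+1, lo g y s t k = mid g s y & hi g y t k = comid g t]].
Proof.
rewrite /lo /hi => kn; have [km|km|->] := ltngtP k m.
- by constructor 1; exists k; split => //; lia.
- case: eqP => [->|h]; first by constructor 3.
  by constructor 1; exists k.-1; split => //; lia.
- by constructor 2.
Qed.

Lemma lo_lt g y s t k : (k < m)%N -> lo g y s t k = ee k.
Proof. by rewrite /lo => ->. Qed.

Lemma lo_m g y s t : lo g y s t m = mid g s t.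
Proof. by rewrite /lo ltnn eqxx. Qed.

Lemma lo_m1 g y s t : lo g y s t m.+1 = mid g s y.
Proof. by rewrite /lo; case: (ltngtP m.+1 m) => [h|h|h]; rewrite ?eqxx //;
  exfalso; lia. Qed.

Lemma hi_m1 g y t : hi g y t m.+1 = comid g t.
Proof. by rewrite /hi; case: (ltngtP m.+1 m) => [h|h|h]; rewrite ?eqxx //;
  exfalso; lia. Qed.

Lemma lohi_gt g y s t k : (m.+1 < k)%N ->
  lo g y s t k = ee k.-1 /\ hi g y t k = ff k.-1.
Proof.
by move=> mk; rewrite /lo /hi; case: (ltngtP k m) => h;
  case: (ltngtP k m.+1) => h' //; exfalso; lia.
Qed.

Lemma om_mid_comid g s t t' : om (mid g s t) (comid g t') = dot g s * det2 t t'.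
Proof.
rewrite /mid /comid /uu /wg !(omE om_form) !(pairE m) ee_ff // eqxx /dot /det2.
by rewrite /=; ring.
Qed.

Lemma om_mid_mid g s t t' : om (mid g s t) (mid g s t') = 0.
Proof. by rewrite /mid /uu !(omE om_form) !(pairE m); ring. Qed.

Lemma om_comid_comid g t t' : om (comid g t) (comid g t') = 0.
Proof. by rewrite /comid /wg !(omE om_form) !(pairE m); ring. Qed.

Lemma om_ee_mid j g s t : om (ee j) (mid g s t) = 0.
Proof. by rewrite /mid /uu !(omE om_form) !(pairE j); ring. Qed.

Lemma om_ff_comid j g t : om (ff j) (comid g t) = 0.
Proof. by rewrite /comid /wg !(omE om_form) !(pairE j); ring. Qed.

Lemma om_ee_comid j g t : (j <= p)%N -> j != m -> om (ee j) (comid g t) = 0.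
Proof.
move=> jp jm; rewrite /comid /wg !(omE om_form) !(pairE j) ee_ff // (negbTE jm).
by rewrite /=; ring.
Qed.

Lemma om_mid_ff j g s t : (j <= p)%N -> j != m -> om (mid g s t) (ff j) = 0.
Proof.
move=> jp jm; rewrite /mid /uu !(omE om_form) !(pairE j) ee_ff //.
by rewrite eq_sym (negbTE jm) /=; ring.
Qed.

Lemma om_lo_lo g y s t i j : (i < n)%N -> (j < n)%N ->
  om (lo g y s t i) (lo g y s t j) = 0.
Proof.
move=> hi hj.
case: (lohiP g y s t hi) => [[i' [_ _ _ -> _]]|[_ -> _]|[_ -> _]];
case: (lohiP g y s t hj) => [[j' [_ _ _ -> _]]|[_ -> _]|[_ -> _]];
by rewrite ?ee_ee ?om_mid_mid ?om_ee_mid //; apply: om_eq0C => //;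
  rewrite om_ee_mid.
Qed.

Lemma om_hi_hi g y t i j : (i < n)%N -> (j < n)%N ->
  om (hi g y t i) (hi g y t j) = 0.
Proof.
move=> hi hj.
case: (lohiP g y 0 t hi) => [[i' [_ _ _ _ ->]]|[_ _ ->]|[_ _ ->]];
case: (lohiP g y 0 t hj) => [[j' [_ _ _ _ ->]]|[_ _ ->]|[_ _ ->]];
by rewrite ?ff_ff ?om_comid_comid ?om_ff_comid //; apply: om_eq0C => //;
  rewrite om_ff_comid.
Qed.

Lemma om_lo_hi g y s t i j : dot g s != 0 -> det2 t y != 0 ->
  (i < n)%N -> (j < n)%N ->
  (om (lo g y s t i) (hi g y t j) == 0) = (i != j).
Proof.
move=> gs ty hi hj.
have yt : det2 y t != 0 by rewrite det2C oppr_eq0.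
case: (lohiP g y s t hi) => [[i' [ip im Ei -> _]]|[-> -> _]|[-> -> _]];
case: (lohiP g y s t hj) => [[j' [jp jm Ej _ ->]]|[-> _ ->]|[-> _ ->]];
rewrite ?ee_ff ?om_ee_comid ?om_mid_ff ?om_mid_comid ?det2_diag ?mulr0 ?eqxx //.
- have -> : ((i' == j')%:R == 0 :> K) = (i' != j') 
    by case: (i' == j'); [exact/negbTE/oner_neq0 | exact: eqxx].
  by move: Ei Ej im jm; case: (leqP i m); case: (leqP j m) => h1 h2 -> -> im jm;
    congr (~~ _); apply/eqP/eqP; lia.
- by move: Ei im; case: (leqP i m) => h ->; lia.
- by move: Ei im; case: (leqP i m) => h ->; lia.
- by move: Ej jm; case: (leqP j m) => h ->; lia.
- by rewrite mulf_eq0 (negbTE gs) (negbTE ty).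
- by rewrite -[RHS]negbK; lia.
- by move: Ej jm; case: (leqP j m) => h ->; lia.
- by lia.
- by rewrite mulf_eq0 (negbTE gs) (negbTE yt).
Qed.

Local Notation flag := {ffun 'I_(n.*2).+1 -> {vspace V}}.

Definition component : set flag :=
  [set F : flag | fibre F /\ (x @: F (inord m.+2) <= F (inord m))%VS].

Lemma frame_lo g y st (j : 'I_n.*2) : (j < n)%N ->
  frame g y st j = lo g y st.1 st.2 j.
Proof. by move=> jn; rewrite ffunE jn. Qed.

Lemma frame_hi g y st (j : 'I_n.*2) : (n <= j)%N ->
  frame g y st j = hi g y st.2 (n.*2.-1 - j).
Proof. by move=> jn; rewrite ffunE ltnNge jn. Qed.

Lemma frame_pair g y st : dot g st.1 != 0 -> det2 st.2 y != 0 ->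
  forall i j, (om (frame g y st i) (frame g y st j) == 0) = (j != rev_ord i).
Proof.
move=> gs ty i j; have iN := ltn_ord i; have jN := ltn_ord j.
have revE : (j != rev_ord i) = (j != (n.*2 - i.+1)%N :> nat) by [].
case: (ltnP i n) => hi; case: (ltnP j n) => hj;
  rewrite ?(frame_lo g y st hi) ?(frame_lo g y st hj)
    ?(frame_hi g y st hi) ?(frame_hi g y st hj).
- by rewrite om_lo_lo // eqxx revE; lia.
- by rewrite om_lo_hi // ?revE; lia.
- rewrite (omC om_form) oppr_eq0 om_lo_hi // ?revE; lia.
- by rewrite om_hi_hi ?eqxx ?revE; lia.
Qed.

Lemma mid_comb g s t t' k l : k *: mid g s t - l *: mid g s t' =
  (dot g s * (k * t 0 0 - l * t' 0 0)) *: ee m + (k * t 0 1 - l * t' 0 1) *: uu s.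
Proof.
rewrite /mid; move: (uu s) (ee m) => u e.
rewrite !scalerDr !scalerA opprD addrACA -!scalerBl.
by congr (_ *: _ + _); ring.
Qed.

(** Cramer's rule: one combination eliminates [uu s], the other [ee m], and [det2 t y] is left as a
    factor. *)
Lemma mid_span (G : {vspace V}) g s t y : dot g s != 0 -> det2 t y != 0 ->
  mid g s t \in G -> mid g s y \in G -> ee m \in G /\ uu s \in G.
Proof.
move=> gs ty ht hy; split.
  have : y 0 1 *: mid g s t - t 0 1 *: mid g s y \in G.
    by rewrite rpredB ?rpredZ.
  rewrite mid_comb [y 0 1 * t 0 1]mulrC subrr scale0r addr0 rpredZeq.
  have -> : y 0 1 * t 0 0 - t 0 1 * y 0 0 = det2 t y by rewrite /det2; ring.
  by rewrite mulf_eq0 (negbTE gs) (negbTE ty).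
have : t 0 0 *: mid g s y - y 0 0 *: mid g s t \in G.
  by rewrite rpredB ?rpredZ.
rewrite mid_comb [t 0 0 * y 0 0]mulrC subrr mulr0 scale0r add0r rpredZeq.
have -> : t 0 0 * y 0 1 - y 0 0 * t 0 1 = det2 t y by rewrite /det2; ring.
by rewrite (negbTE ty).
Qed.

Section Frame.
Variables (g y : 'rV[K]_2) (st : 'rV[K]_2 * 'rV[K]_2).
Hypothesis gs : dot g st.1 != 0.
Hypothesis ty : det2 st.2 y != 0.
Local Notation c := (frame g y st).
Local Notation F := (flagof c).

Lemma mem_lo j k : (j < n)%N -> (j < k)%N -> (k <= n.*2)%N ->
  lo g y st.1 st.2 j \in F (inord k).
Proof.
move=> jn jk kn; have jN : (j < n.*2)%N by lia.
rewrite -(frame_lo g y st (j := Ordinal jN)) //.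
by apply: mem_flagof; rewrite inordK.
Qed.

Lemma frame_mem_plane k : (m.+2 <= k <= n.*2)%N ->
  ee m \in F (inord k) /\ uu st.1 \in F (inord k).
Proof.
move=> mk; apply: (mid_span gs ty).
  by rewrite -(lo_m g y); apply: mem_lo; lia.
by rewrite -(lo_m1 g y _ st.2); apply: mem_lo; lia.
Qed.

Lemma frame_mem_ee j k : (j <= p)%N -> (j.+2 <= k <= n.*2)%N ->
  ee j \in F (inord k).
Proof.
move=> jp jk; have [jm|mj|jm] := ltngtP j m.
- by rewrite -(lo_lt g y st.1 st.2 jm); apply: mem_lo; lia.
- have [<- _] := lohi_gt g y st.1 st.2 (mj : (m.+1 < j.+1)%N).
  by apply: mem_lo; lia.
- by rewrite jm; apply: (frame_mem_plane _).1; lia.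
Qed.

Lemma frame_mem_low j k : (j < m)%N -> (j < k <= n.*2)%N ->
  ee j \in F (inord k).
Proof. by move=> jm jk; rewrite -(lo_lt g y st.1 st.2 jm); apply: mem_lo;
  lia. Qed.

Lemma frame_x_low j k : (j <= m)%N -> (j <= k <= n.*2)%N ->
  x (ee j) \in F (inord k).
Proof.
move=> jm jk; rewrite x_ee; last by lia.
by case: eqP => [_|h]; [exact: mem0v | apply: frame_mem_low; lia].
Qed.

(** [x] kills the plane and sends [ee m] to [ee m.-1], or to 0 if [m] is 0. So both middle vectors
    drop into F_m, which is what [component] requires. *)
Lemma frame_x_mid t k : (m <= k <= n.*2)%N -> x (mid g st.1 t) \in F (inord k).
Proof.
move=> mk; rewrite /mid linearD !linearZ /= x_uu scaler0 addr0.
by rewrite memvZ ?frame_x_low.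
Qed.

Lemma frame_component : component F.
Proof.
have gsty := frame_pair gs ty.
have Fib : fibre F.
  apply: (frame_fibre om_form x_adj gsty dimV).
    have -> : v = ee p by rewrite /ee subnn.
    by apply: frame_mem_ee; lia.
  move=> j k jn kj; have -> : k = inord j by apply/val_inj; rewrite /= inordK;
    lia.
  rewrite frame_lo //; have jN : (j <= n.*2)%N by lia.
  case: (lohiP g y st.1 st.2 jn) => [[i [ip im Ei -> _]]|[jm -> _]|[jm -> _]].
  - move: Ei im; case: (leqP j m) => h -> im; first by apply: frame_x_low; lia.
    rewrite x_ee; last by lia.
    by case: eqP => [_|h']; [exact: mem0v | apply: frame_mem_ee; lia].
  - by apply: frame_x_mid; lia.
  - by apply: frame_x_mid; lia.
split => //; apply/subvP => _ /memv_imgP[a ak ->].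
rewrite memv_preim; move: a ak; apply/subvP/flagof_subP => j.
rewrite inordK; last by lia.
move=> jm; have jn : (j < n)%N by lia.
rewrite -memv_preim frame_lo //.
case: (lohiP g y st.1 st.2 jn) => [[i [ip im Ei -> _]]|[_ -> _]|[_ -> _]].
- by apply: frame_x_low; move: Ei im; case: (leqP j m) => h ->; lia.
- by apply: frame_x_mid; lia.
- by apply: frame_x_mid; lia.
Qed.

End Frame.

(** A frame built on any two lines consists of combinations of these vectors, and the perpendicular
    space of its whole span is F_0 = 0. *)
Lemma normal_frame_nondegenerate d : (forall j, (j <= p)%N ->
  om (ee j) d = 0) ->
  (forall j, (j <= p)%N -> om (ff j) d = 0) -> om z d = 0 -> om w d = 0 ->
    d = 0.
Proof.
move=> hee hff hz hw.
have omlin t t' (s : 'rV[K]_2) : om (mid t s t') d = 0.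
  by rewrite /mid /uu !(omE om_form) hz hw hee //; ring.
have omcomid t t' : om (comid t t') d = 0.
  by rewrite /comid /wg !(omE om_form) hz hw hff //; ring.
pose u := vec2 1 0 : 'rV[K]_2; pose u' := vec2 0 1 : 'rV[K]_2.
have uu1 : dot u u != 0.
  by rewrite /dot !vec2_0 !vec2_1 mulr0 mulr1 addr0 oner_neq0.
have uu'1 : det2 u u' != 0.
  by rewrite /det2 !vec2_0 !vec2_1 mulr0 mulr1 subr0 oner_neq0.
have cp := @frame_pair u u' (u, u) uu1 uu'1.
have := frame_perp om_form cp dimV ord_max; set G := flagof _ => perpG.
have : d \in perp om (G ord_max).
  apply: mem_perp_flagof => // j _.
  have [jn|nj] := ltnP j n.
    rewrite frame_lo //.
    by case: (lohiP u u' u u jn) => [[i [ip _ _ -> _]]|[_ -> _]|[_ -> _]];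
      rewrite ?hee.
  rewrite frame_hi //.
  have jn : (n.*2.-1 - j < n)%N by move: (ltn_ord j); lia.
  by case: (lohiP u u' u u jn) => [[i [ip _ _ _ ->]]|[_ _ ->]|[_ _ ->]];
    rewrite ?hff.
rewrite perpG /G flagofE big_pred0 ?memv0 => [/eqP //|j].
by rewrite /= subnn.
Qed.

(** * The two lines recovered from a flag *)

(** Coordinates of the orthogonal projection to <z, w>, read off by pairing because [om z w = 1]. *)
Definition prj a : 'rV[K]_2 := vec2 (om a w) (om z a).
(** The coefficient of [ee m] and the value of [g] on the plane component. On [mid g s t] both carry
    the factor [dot g s], so the line of [t] is recovered whatever generator [s] is used. *)
Definition rho g a : 'rV[K]_2 := vec2 (om a (ff m)) (dot g (prj a)).

Lemma prj_linear : linear prj.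
Proof.
move=> k a b; apply/rowP => j; rewrite !mxE.
by case: ifP => _; rewrite !(omE om_form).
Qed.

Lemma rho_linear g : linear (rho g).
Proof.
move=> k a b; apply/rowP => j; rewrite !mxE /dot prj_linear.
by case: ifP => _; rewrite ?(omE om_form) // !mxE; ring.
Qed.

Lemma linfun_prj a : linfun prj a = prj a.
Proof.
pose h : {linear V -> 'rV[K]_2} :=
  HB.pack prj (GRing.isLinear.Build _ _ _ _ prj prj_linear).
exact: (lfunE h).
Qed.

Lemma linfun_rho g a : linfun (rho g) a = rho g a.
Proof.
pose h : {linear V -> 'rV[K]_2} :=
  HB.pack (rho g) (GRing.isLinear.Build _ _ _ _ (rho g) (rho_linear g)).
exact: (lfunE h).
Qed.

Lemma prj_ee j : prj (ee j) = 0.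
Proof.
by apply/rowP => k; rewrite !mxE !(pairE j); case: ifP.
Qed.

Lemma prj_uu s : prj (uu s) = s.
Proof.
rewrite [RHS]vec2_eta /prj /uu; congr vec2; rewrite !(omE om_form) !(pairE m);
by ring.
Qed.

Lemma prj_mid g s t : prj (mid g s t) = t 0 1 *: s.
Proof.
by rewrite -linfun_prj /mid linearD !linearZ /= !linfun_prj prj_ee prj_uu scaler0 add0r.
Qed.

Lemma rho_ee g j : (j < m)%N -> rho g (ee j) = 0.
Proof.
move=> jm; rewrite /rho prj_ee ee_ff ?ltn_eqF //; last by lia.
by apply/rowP => k; rewrite !mxE /dot !mxE !mulr0 addr0; case: ifP.
Qed.

Lemma rho_mid g s t : rho g (mid g s t) = dot g s *: t.
Proof.
rewrite /rho prj_mid [RHS]vec2_eta !mxE; congr vec2; last by rewrite dotZ mulrC.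
by rewrite /mid /uu !(omE om_form) !(pairE m) ee_ff // eqxx /=; ring.
Qed.

Lemma frame_prj g y st : dot g st.1 != 0 -> det2 st.2 y != 0 ->
  (linfun prj @: flagof (frame g y st) (inord n))%VS = <[st.1]>%VS.
Proof.
move=> gs ty; apply/eqP; rewrite eqEsubv; apply/andP; split.
  apply/subvP => _ /memv_imgP[a ak ->].
  rewrite memv_preim; move: a ak; apply/subvP/flagof_subP => j.
  rewrite inordK; last by lia.
  move=> jn; rewrite -memv_preim linfun_prj frame_lo //.
  case: (lohiP g y st.1 st.2 jn) => [[i [ip im Ei -> _]]|[_ -> _]|[_ -> _]].
  - by rewrite prj_ee mem0v.
  - by rewrite prj_mid memvZ ?memv_line.
  - by rewrite prj_mid memvZ ?memv_line.
rewrite -memvE -[X in X \in _](prj_uu st.1) -linfun_prj memv_img //.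
by apply: (frame_mem_plane gs ty _).2; lia.
Qed.

(** Together with [frame_prj] this inverts the parametrization by frames: both lines are linear
    images of members of the flag, hence depend on it by morphisms. *)
Lemma frame_rho g y st : dot g st.1 != 0 -> det2 st.2 y != 0 ->
  (linfun (rho g) @: flagof (frame g y st) (inord m.+1))%VS = <[st.2]>%VS.
Proof.
move=> gs ty; apply/eqP; rewrite eqEsubv; apply/andP; split.
  apply/subvP => _ /memv_imgP[a ak ->].
  rewrite memv_preim; move: a ak; apply/subvP/flagof_subP => j.
  rewrite inordK; last by lia.
  move=> jm; have jn : (j < n)%N by lia.
  rewrite -memv_preim linfun_rho frame_lo //.
  move: jm; rewrite ltnS leq_eqVlt => /orP[/eqP ->|jm].
    by rewrite lo_m rho_mid memvZ ?memv_line.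
  by rewrite lo_lt // rho_ee // mem0v.
have -> : (<[st.2]> = <[dot g st.1 *: st.2]>)%VS.
  apply/eqP; rewrite eqEsubv -!memvE memvZ ?memv_line // andbT.
  by apply/vlineP; exists (dot g st.1)^-1; rewrite scalerA mulVf // scale1r.
rewrite -memvE -rho_mid -linfun_rho memv_img // -(lo_m g y).
by apply: mem_lo; lia.
Qed.

(** Rescaling [s] and [t] only multiplies the middle vectors of the first half by scalars, so the
    flag of a frame is a function of the two lines. *)
Lemma frame_scale g y s t c c' : dot g s != 0 -> det2 t y != 0 ->
  c != 0 -> c' != 0 ->
  flagof (frame g y (c *: s, c' *: t)) = flagof (frame g y (s, t)).
Proof.
move=> gs ty c0 c'0.
have gs' : dot g (c *: s, c' *: t).1 != 0 by rewrite /= dotZ mulf_neq0.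
have ty' : det2 (c *: s, c' *: t).2 y != 0 by rewrite /= det2Z mulf_neq0.
have [hF _] := frame_component gs' ty'.
apply: (fibre_eq_frame om_form (frame_pair (st := (s, t)) gs ty) dimV hF).
move=> j k jk kn; have jn : (j < n)%N := leq_trans jk kn.
have jN : (j < n.*2)%N := ltn_ord j.
have := mem_lo gs' ty' jn jk; rewrite frame_lo //= inord_val.
have kN : (k <= n.*2)%N := ltn_ord k.
move=> /(_ kN).
have midZ c1 s1 t1 : mid g (c1 *: s1) t1 = c1 *: mid g s1 t1.
  have -> : mid g (c1 *: s1) t1 = (dot g (c1 *: s1) * t1 0 0) *: ee m +
      t1 0 1 *: (c1 *: uu s1).
    by rewrite /mid; congr (_ + _ *: _); rewrite /uu !mxE scalerDr !scalerA.
  rewrite dotZ /mid; move: (uu s1) (ee m) => u e.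
  by rewrite scalerDr !scalerA; congr (_ *: _ + _ *: _); ring.
have midZ' s1 c1 t1 : mid g s1 (c1 *: t1) = c1 *: mid g s1 t1.
  rewrite /mid !mxE; move: (uu s1) (ee m) => u e.
  by rewrite scalerDr !scalerA; congr (_ *: _ + _ *: _); ring.
case: (lohiP g y s t jn) => [[i [ip im Ei -> _]]|[-> -> _]|[-> -> _]].
- case: (lohiP g y (c *: s) (c' *: t) jn) => [[i' [_ _ -> -> _]]|[jm _ _]|[jm _ _]].
  + by rewrite Ei.
  + by move: Ei im; rewrite jm leqnn => ->; rewrite eqxx.
  + by move: Ei im; rewrite jm ltnn => ->; rewrite eqxx.
- by rewrite lo_m midZ midZ' scalerA rpredZeq mulf_eq0 (negbTE c0) (negbTE c'0).
- by rewrite lo_m1 midZ rpredZeq (negbTE c0).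
Qed.

(** * Every flag of the component comes from a frame *)

(** The difference of the two sides is orthogonal to the whole normal frame. *)
Lemma component_expand a :
  (forall j, (j <= p)%N -> om (ee j) a = 0) ->
  (forall j, (m < j <= p)%N -> om a (ff j) = 0) ->
  a = \sum_(j < m.+1) om a (ff j) *: ee j + uu (prj a).
Proof.
move=> hee hff; apply/eqP; rewrite -subr_eq0; apply/eqP.
have sum0 b : (forall j, (j <= m)%N -> om b (ee j) = 0) ->
    om b (\sum_(j < m.+1) om a (ff j) *: ee j) = 0.
  move=> hb; rewrite (om_sumr om_form) big1 // => j _.
  by rewrite (omZr om_form) hb ?mulr0 // -ltnS.
apply: normal_frame_nondegenerate => [j jp|j jp||].
- rewrite !(omE om_form) hee // sum0 => [|i _]; last by rewrite ee_ee.
  by rewrite /uu ?(omE om_form) !(pairE j); ring.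
- have -> : om (ff j) (a - (\sum_(j < m.+1) om a (ff j) *: ee j + uu (prj a))) =
     om (ff j) a - om (ff j) (\sum_(j < m.+1) om a (ff j) *: ee j).
    by rewrite !(omE om_form) /uu ?(omE om_form) !(pairE j); ring.
  rewrite (om_sumr om_form); have [jm|mj] := leqP j m; last first.
    rewrite (om_eq0C om_form) ?hff ?mj // big1 ?subr0 // => i _.
    rewrite (omZr om_form) ff_ee //; last by move: (ltn_ord i); lia.
    have -> : (nat_of_ord i == j) = false by move: (ltn_ord i); lia.
    by rewrite oppr0 mulr0.
  have jm' : (j < m.+1)%N by [].
  rewrite (bigD1 (Ordinal jm')) //= big1 => [|i ij].
    rewrite (omZr om_form) ff_ee // eqxx addr0 (omC om_form (ff j)).
    by rewrite /=; ring.
  rewrite (omZr om_form) ff_ee //; last by move: (ltn_ord i); lia.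
  by have /negbTE -> : (nat_of_ord i != j) := ij; rewrite oppr0 mulr0.
- rewrite !(omE om_form) sum0 => [|i _]; last by rewrite !(pairE i).
  by rewrite /uu /prj ?(omE om_form) !vec2_0 !vec2_1 !(pairE m); ring.
- rewrite !(omE om_form) sum0 => [|i _]; last by rewrite !(pairE i).
  rewrite /uu /prj ?(omE om_form) !vec2_0 !vec2_1 !(pairE m) (omC om_form w a).
  by ring.
Qed.

(** [ee j] is [x^(p-j) v] with [v] in F_n, and [n = p + 2] accounts for the shift by two. *)
Lemma fibre_ee F j : fibre F -> (j <= p)%N -> ee j \in F (inord j.+2).
Proof.
move=> hF jp; have := fibre_vn hF (j := p - j); rewrite -/(ee j).
have -> : (n - (p - j) = j.+2)%N by lia.
by apply; lia.
Qed.

Lemma fibre_ee_low F j : fibre F -> (m = 0%N \/ ee m.-1 \in F (inord m)) ->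
  (j < m)%N -> ee j \in F (inord j.+1).
Proof.
move=> hF [->//|h] jm.
have -> : ee j = iter (m.-1 - j) x (ee m.-1).
  by rewrite /ee -iterD; congr (iter _ x _); lia.
by apply: (fibre_iter hF h); lia.
Qed.

(** The inclusion defining [component] gains one step over [fibre_ee]: it puts [ee m.-1 = x (ee m)]
    into F_m, and powers of [x] carry the gain to lower indices. *)
Lemma component_ee F j : component F -> (j < m)%N -> ee j \in F (inord j.+1).
Proof.
move=> [hF xF]; apply: fibre_ee_low => //.
have [m0|m0] := posnP m; [by left | right].
have -> : ee m.-1 = x (ee m) by rewrite x_ee // gtn_eqF.
by apply: (subvP xF); rewrite memv_img ?fibre_ee.
Qed.

(** The isotropic space F_n contains [a] and all [ee j]. For [j > m], adjointness turns the pairing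
    of [a] with [ff j = x (ff j.-1)] into that of [x a] with [ff j.-1]; it is 0 because [x a] lies
    in F_m, which is spanned by the [ee] of index below [m]. *)
Lemma component_uu_span F a : component F -> a \in F (inord m.+2) ->
  a = \sum_(j < m.+1) om a (ff j) *: ee j + uu (prj a).
Proof.
move=> hF ha; have [Fib xF] := hF; apply: component_expand => j.
  move=> jp; apply: (fibre_om om_form Fib (fibre_ee Fib jp) ha); lia.
move=> /andP[mj jp]; have -> : ff j = x (ff j.-1).
  by rewrite -[RHS]/(iter j.-1.+1 x f); congr (iter _ x _); lia.
rewrite -x_adj; apply: om_eq0C => //.
have xa : x a \in F (inord m) by apply: (subvP xF); apply: memv_img.
have Fm : (F (inord m) <= \sum_(i < m) <[ee i]>)%VS.
  have low : (\sum_(i < m) <[ee i]> <= F (inord m))%VS.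
    apply/subv_sumP => i _; rewrite -memvE.
    by apply: (fibre_mono Fib _ (component_ee hF (ltn_ord i)));
      move: (ltn_ord i); lia.
  suff /eqP <- : ((\sum_(i < m) <[ee i]>)%VS == F (inord m)) by [].
  rewrite eqEdim low (fibre_dim Fib); last by lia.
  have hfree : free [seq ee i | i <- iota 0 m].
    apply: (dual_free om_form (d := ff)) => [i i'|i];
      rewrite size_map size_iota.
      move=> im i'm ii'; rewrite (nth_map 0%N) ?size_iota // nth_iota //.
      by rewrite ee_ff ?(negbTE ii') //; lia.
    move=> im; rewrite (nth_map 0%N) ?size_iota // nth_iota // ee_ff ?eqxx;
      try lia.
    exact: oner_neq0.
  have -> : (\sum_(i < m) <[ee i]>)%VS = <<[seq ee i | i <- iota 0 m]>>%VS.
    have -> : iota 0 m = index_iota 0 m by rewrite /index_iota subn0.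
    by rewrite span_def big_map big_mkord.
  by rewrite (eqP hfree) size_map size_iota leqnn.
move: (subvP Fm _ xa) => /memv_sumP[b hb ->].
rewrite (om_sumr om_form) big1 // => i _; have /vlineP[l ->] := hb i isT.
rewrite (omZr om_form) ff_ee; try by move: (ltn_ord i); lia.
have -> : (nat_of_ord i == j.-1) = false by move: (ltn_ord i); lia.
by rewrite oppr0 mulr0.
Qed.

Lemma exists_notin_ee F k : fibre F -> (k <= n.*2)%N -> forall l, (l < k)%N ->
  exists2 a, a \in F (inord k) & a \notin (\sum_(j < l) <[ee j]>)%VS.
Proof.
move=> hF kn l lk; apply/subvPn; apply/negP => /dimvS.
rewrite (fibre_dim hF) // leqNgt => /negP; apply.
apply: leq_ltn_trans lk; apply: (leq_trans (dimv_leq_sum _ _ _)).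
rewrite -[X in (_ <= X)%N]card_ord -sum1_card; apply: leq_sum => j _.
by rewrite dim_vline leq_b1.
Qed.

(** The order of the quantifiers matters: [s] depends on the flag alone, [t] also on the chart [g],
    and [y] may be any vector independent of [t]. *)
Lemma component_frame F : component F -> exists2 s : 'rV[K]_2, s != 0 &
  forall g, dot g s != 0 -> exists2 t : 'rV[K]_2, t != 0 &
  forall y, det2 t y != 0 -> F = flagof (frame g y (s, t)).
Proof.
move=> hF; have [Fib xF] := hF.
have memF j : (j <= m)%N -> ee j \in F (inord m.+2).
  by move=> jm; apply: (fibre_mono Fib _ (fibre_ee Fib _)); clear -np mp jm;
    lia.
have uuF a : a \in F (inord m.+2) -> uu (prj a) \in F (inord m.+2).
  move=> ha; have := component_uu_span hF ha => E.
  have -> : uu (prj a) = a - \sum_(j < m.+1) om a (ff j) *: ee j.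
    by rewrite [X in _ = X - _]E addrAC subrr add0r.
  by rewrite rpredB // rpred_sum // => j _; rewrite memvZ ?memF // -ltnS.
(* The vectors [ee 0], ..., [ee m] cannot span F_{m+2}; a vector outside their span has a nonzero
   projection to the plane, which serves as [s]. *)
have [|a ha an] := exists_notin_ee Fib (k := m.+2) _ (ltnSn m.+1); first by lia.
have s0 : prj a != 0.
  apply: contraNneq an => pa; rewrite (component_uu_span hF ha) pa.
  have -> : uu 0 = 0 by rewrite /uu !mxE !scale0r addr0.
  rewrite addr0 memv_sumr // => j _; by rewrite memvZ ?memv_line.
exists (prj a) => // g gs; set s := prj a in s0 gs *.
have us : uu s \in F (inord m.+2) by apply: uuF.
have [|b hb bn] := exists_notin_ee Fib (k := m.+1) _ (ltnSn m); first by lia.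
have hb' : b \in F (inord m.+2) by apply: (fibre_mono Fib _ hb); clear -np mp;
  lia.
(* F_{m+2} is isotropic since [m + 2 <= n], and the form on the plane is a determinant, so its
   vectors have proportional projections. *)
have [c pb] : exists c, prj b = c *: s.
  apply: det2_eq0 => //.
  have : om (uu s) (uu (prj b)) = 0.
    by apply: (fibre_om om_form Fib us (uuF _ hb')); clear -np mp; lia.
  rewrite /uu !(omE om_form) !(pairE m) => E; rewrite /det2 -{}E.
  by ring.
have Eb := component_uu_span hF hb'; rewrite pb in Eb.
(* The division cancels the factor [dot g s] in [mid], so that [mid g s t] is [b] modulo [ee 0],
   ..., [ee m.-1]. *)
pose t := vec2 (om b (ff m) / dot g s) c.
have midb : mid g s t = b - \sum_(j < m) om b (ff j) *: ee j.
  have Eb2 : b = \sum_(j < m) om b (ff j) *: ee j +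
      (om b (ff m) *: ee m + uu (c *: s)).
    by rewrite {1}Eb big_ord_recr /= -addrA.
  rewrite [X in _ = X - _]Eb2 addrAC subrr add0r.
  rewrite /mid vec2_0 vec2_1 mulrC divfK //; congr (_ + _).
  by rewrite /uu !mxE scalerDr !scalerA.
have midF : mid g s t \in F (inord m.+1).
  rewrite midb rpredB // rpred_sum // => j _; rewrite memvZ //.
  by apply: (fibre_mono Fib _ (component_ee hF (ltn_ord j)));
    move: (ltn_ord j); clear -np mp; lia.
exists t.
  apply: contraNneq bn => t0.
  have -> : b = \sum_(j < m) om b (ff j) *: ee j.
    apply/eqP; rewrite -subr_eq0 -midb t0.
    by rewrite /mid !mxE mulr0 !scale0r addr0.
  by rewrite memv_sumr // => j _; rewrite memvZ ?memv_line.
move=> y ty;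
  apply: (fibre_eq_frame om_form (frame_pair (st := (s, t)) gs ty) dimV Fib).
move=> j k jk kn; have jn : (j < n)%N := leq_trans jk kn.
rewrite frame_lo //= -(inord_val k).
have kN : (j < k <= n.*2)%N by rewrite jk; apply: (ltn_ord k).
case: (lohiP g y s t jn) => [[i [ip im Ei -> _]]|[jm -> _]|[jm -> _]].
- move: Ei im; case: (leqP j m) => h -> im.
    have jm : (j < m)%N by rewrite ltn_neqAle im.
    by apply: (fibre_mono Fib _ (component_ee hF jm)).
  by apply: (fibre_mono Fib _ (fibre_ee Fib _)); clear -np mp h jn kN; lia.
- by apply: (fibre_mono Fib _ midF); clear -jm kN; lia.
- apply: (fibre_mono Fib (j := m.+2)); first by clear -jm kN; lia.
  by rewrite /mid rpredD ?memvZ ?memF.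
Qed.

(** * Exotic types along a flag, and the cell *)

Local Notation qform F k := (@quo_form _ _ om (F (inord k))).
Local Notation qend F k := (quo_end om (F (inord k)) x).
Local Notation qv F k := (to_quo om (F (inord k)) v).

Definition phi_is (F : flag) k munu : Prop := eType (qform F k) (qv F k) (qend F k) munu.

Lemma fibre_isotropic F k : fibre F -> (k <= n)%N ->
  (F (inord k) <= perp om (F (inord k)))%VS.
Proof.
move=> hF kn; apply/subvP => a ha; apply/(memv_perp om_form) => b hb.
by apply: (fibre_om om_form hF hb ha); rewrite addnn leq_double.
Qed.

Lemma fibre_stable F k : fibre F -> (k <= n)%N ->
  (x @: F (inord k) <= F (inord k))%VS.
Proof.
move=> hF kn; have k2n : (k <= n.*2)%N by apply: leq_trans kn _;
  rewrite -addnn leq_addr.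
apply/subvP => _ /memv_imgP[a ha ->].
by apply: (fibre_iter hF ha (j := 1)) => //; rewrite leq_addr.
Qed.

Lemma fibre_v F : fibre F -> v \in F (inord n).
Proof. by case. Qed.

Lemma fibre_v_perp F k : fibre F -> (k <= n)%N -> v \in perp om (F (inord k)).
Proof.
move=> hF kn; apply/(memv_perp om_form) => b hb.
by apply: (fibre_om om_form hF hb (fibre_v hF)); rewrite -addnn leq_add2r.
Qed.

Lemma fibre_dim_quo F k : fibre F -> (k <= n)%N ->
  \dim {: perp_quo om (F (inord k))} = (n - k).*2.
Proof.
move=> hF kn; rewrite dim_perp_quo; last exact: fibre_isotropic.
have k2n : (k <= n.*2)%N by apply: leq_trans kn _; rewrite -addnn leq_addr.
rewrite (fibre_perp hF) // !(fibre_dim hF) //; last by rewrite leq_subr.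
by clear -kn; lia.
Qed.

Lemma phi_component F : fibre F ->
  phi_is F m ([:: (n - m).-1;
    1%N], [::]) -> phi_is F m.+1 ([:: n - m.+1]%N, [::]) ->
  component F /\ ee m \notin F (inord m.+1).
Proof.
move=> hF h0 h1.
have mn : (m <= n)%N by clear -np mp; lia.
have mn1 : (m.+1 <= n)%N by clear -np mp; lia.
have iso := fibre_isotropic hF mn; have st := fibre_stable hF mn.
have iso1 := fibre_isotropic hF mn1; have st1 := fibre_stable hF mn1.
(* This vector is [x (ee m)]; writing it as a power of [x] applied to [v] avoids a separate case
   [m = 0]. *)
have low : iter (p - m).+1 x v \in F (inord m).
  have r0 : (0 < (n - m).-1)%N by clear -np mp; lia.
  have [_ [f' [z' [w' [[v0 _ _] _ _ _ _]]]]] :=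
    eType_row2_inv (quo_form_alternating om_form _) r0 h0.
  move: v0 => /eqP;
    rewrite (iter_quo_end_eq0 om_form x_adj st) ?fibre_v_perp //.
  by have -> : ((n - m).-1 = (p - m).+1)%N by clear -np mp; lia.
have high : ee m \notin F (inord m.+1).
  have r0 : (0 < n - m.+1)%N by clear -np mp; lia.
  have := eType_row1_inv (quo_form_alternating om_form _) r0 h1.
  rewrite (iter_quo_end_eq0 om_form x_adj st1) ?fibre_v_perp //.
  by have -> : ((n - m.+1).-1 = p - m)%N by clear -np mp; lia.
split => //; split => //.
have m12 : (F (inord m.+1) + <[ee m]> <= F (inord m.+2))%VS.
  rewrite subv_add -memvE fibre_ee // andbT; apply/subvP => a ha.
  by apply: (fibre_mono hF _ ha); clear -np mp; lia.
have -> : F (inord m.+2) = (F (inord m.+1) + <[ee m]>)%VS.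
  apply/esym/eqP; rewrite eqEdim m12 (fibre_dim hF); last by clear -np mp; lia.
  have d1 : \dim (F (inord m.+1)) = m.+1.
    by rewrite (fibre_dim hF) //; clear -np mp; lia.
  rewrite -{1}d1 ltnNge; apply: contra high => hd.
  have /eqP -> : F (inord m.+1) == (F (inord m.+1) + <[ee m]>)%VS.
    by rewrite eqEdim addvSl.
  by rewrite (subvP (addvSr _ _)) // memv_line.
rewrite limgD subv_add; apply/andP; split.
  apply/subvP => _ /memv_imgP[a ha ->].
  by apply: (fibre_iter hF ha (j := 1)); clear -np mp; lia.
by rewrite limg_line -memvE.
Qed.

(** Up to step [m] the flag only shortens the long chains: in the quotient [v] keeps its place,
    [ff k] replaces [f], and the plane survives. *)
Lemma component_phi_low F k : component F -> (k <= m)%N ->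
  phi_is F k ([:: (n - k).-1; 1%N], [::]).
Proof.
move=> hF km; have [Fib _] := hF.
have kn : (k <= n)%N by clear -km np mp; lia.
have kp : (k <= p)%N by clear -km np mp; lia.
have iso := fibre_isotropic Fib kn; have st := fibre_stable Fib kn.
have [s s0 hs] := component_frame hF; have [g gs] := exists_dot s0.
have [t t0 ht] := hs g gs; have [y ty] := exists_det2 t0.
have perpI b : (forall j, (j < k)%N -> om (ee j) b = 0) ->
    b \in perp om (F (inord k)).
  move=> hb; rewrite (ht y ty); apply: mem_perp_flagof => // j.
  rewrite inordK => [jk|]; last by clear -kn; lia.
  by rewrite frame_lo ?(leq_trans jk) // lo_lt ?(leq_trans jk) // hb.
have [[v0 f0 vf] [xz xw] zw [vz vw] [fz fw]] := nf.
have fk j : iter j x (ff k) = iter (j + k) x f by rewrite iterD.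
have [ffz ffw _ _] := ff_zw k.
apply: (@eType_normal _ _ _ (quo_form_alternating om_form _) _
  (quo_end_adj om_form x_adj iso st) K2 _ _ (to_quo om _ (ff k))
  (to_quo om _ z) (to_quo om _ w)).
- by clear -km np mp; lia.
- by rewrite fibre_dim_quo //; clear -km np mp; lia.
apply: normal_frame_quo => //.
- exact: fibre_v_perp.
- apply: perpI => j jk; rewrite ee_ff ?ltn_eqF //; clear -jk kp; lia.
- by apply: perpI => j jk; have [-> _ _ _] := ee_zw j.
- by apply: perpI => j jk; have [_ -> _ _] := ee_zw j.
- have [k0|k0] := posnP k.
    by rewrite (iter_eq0 v0) ?mem0v // k0; clear -np; lia.
  have -> : iter (n - k).-1 x v = ee k.-1.
    by congr (iter _ x _); clear -k0 kp np; lia.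
  have km1 : (k.-1 < m)%N by rewrite prednK.
  by have := component_ee hF km1; rewrite prednK.
- by rewrite fk (iter_eq0 f0) ?mem0v //; clear -kp np; lia.
- move=> j hj; rewrite (chain_pairE om_form x_adj _ _ (And3 v0 f0 vf)).
  by congr (_%:R); congr nat_of_bool; clear -kp np; lia.
Qed.

(** Beyond step [m] a single pair of chains is left. The chain of [v] needs a dual generator [f']
    orthogonal to F_k: it is [ff k.-1] in general, a multiple of [comid g t] for [k = m + 1], and 0
    for [k = n]. *)
Lemma component_phi_high F k : component F -> ee m \notin F (inord m.+1) ->
  (m < k <= n)%N -> phi_is F k ([seq l <- [:: (n - k)%N] | (0 < l)%N], [::]).
Proof.
move=> hF em /andP[mk kn]; have [Fib _] := hF.
have k2n : (k <= n.*2)%N by apply: leq_trans kn _; rewrite -addnn leq_addr.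
have iso := fibre_isotropic Fib kn; have st := fibre_stable Fib kn.
have [s s0 hs] := component_frame hF; have [g gs] := exists_dot s0.
have [t t0 ht] := hs g gs; have [y ty] := exists_det2 t0.
have FE := ht y ty.
(* Otherwise [mid g s t], which lies in F_{m+1}, would be a nonzero multiple of [ee m]. *)
have t1 : t 0 1 != 0.
  apply: contraNneq em => t10.
  have midF : mid g s t \in F (inord m.+1).
    rewrite FE -(lo_m g y); apply: (mem_lo (st := (s, t)) gs ty) => //;
      clear -np mp; lia.
  have t00 : t 0 0 != 0 by move: t0; rewrite row2_neq0 t10 eqxx orbF.
  move: midF; rewrite /mid t10 scale0r addr0 rpredZeq mulf_eq0.
  by rewrite (negbTE gs) (negbTE t00).
have [[v0 f0 vf] [xz xw] zw [vz vw] [fz fw]] := nf.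
have [f' [f'perp f'0 vf']] : exists f', [/\ f' \in perp om (F (inord k)),
    iter (n - k) x f' \in F (inord k) &
    forall j, (j < n - k)%N -> om (iter j x v) f' = (j.+1 == (n - k)%N)%:R].
  have [nk|nk] := leqP n k.
    exists 0; split; rewrite ?mem0v // ?iter0 ?mem0v //.
    by move=> j; have -> : (n - k = 0)%N by clear -nk; lia.
  have perpI b : (forall j, (j < k)%N -> om (lo g y s t j) b = 0) ->
      b \in perp om (F (inord k)).
    move=> hb; rewrite FE; apply: mem_perp_flagof => // j.
    by rewrite inordK // => jk; rewrite frame_lo ?(leq_trans jk) // hb.
  have hiperp j : (j < k)%N -> om (lo g y s t j) (hi g y t k) = 0.
    move=> jk; apply/eqP; rewrite om_lo_hi ?ltn_eqF //.
    exact: ltn_trans jk nk.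
  have vz' j : om (iter j x v) z = 0.
    by have [] := normal_frame_orth om_form x_adj j nf.
  have vw' j : om (iter j x v) w = 0.
    by have [] := normal_frame_orth om_form x_adj j nf.
  move: mk; rewrite leq_eqVlt => /orP[/eqP mk|mk].
    (* The scalar gives [ff m] the coefficient 1; the remaining term lies in the plane, which is
       orthogonal to the chain of [v]. *)
    exists ((t 0 1)^-1 *: comid g t); split.
    - rewrite memvZ // perpI // => j jk.
      by rewrite -(hi_m1 g y) mk hiperp.
    - have -> : iter (n - k) x ((t 0 1)^-1 *: comid g t) =
          (t 0 1)^-1 *: iter (n - k) x (comid g t).
        by have := iter_lin x (n - k) (t 0 1)^-1 (comid g t) 0;
          rewrite iter0 !addr0.
      have -> : iter (n - k) x (comid g t) = 0.
        have -> : (n - k = (p - m).+1)%N by clear -mk np mp; lia.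
        rewrite iterSr x_comid.
        have := iter_lin x (p - m) (t 0 1) (x (ff m)) 0.
        rewrite iter0 !addr0 => ->; rewrite -iterSr /ff -iterD (iter_eq0 f0).
          by rewrite scaler0.
        by clear -mp; lia.
      by rewrite scaler0 mem0v.
    - move=> j jk; rewrite /comid /wg !(omE om_form) vz' vw'.
      rewrite (chain_pairE om_form x_adj _ _ (And3 v0 f0 vf)).
      have -> : ((j + m).+1 == p.+1) = (j.+1 == n - k)%N by clear -mk np mp;
        lia.
      by field.
  have [_ hiE] := lohi_gt g y s t mk.
  exists (ff k.-1); split.
  - by rewrite -hiE; apply: perpI.
  - rewrite /ff -iterD (iter_eq0 f0) ?mem0v //; clear -np mk nk; lia.
  - move=> j jk; rewrite (chain_pairE om_form x_adj _ _ (And3 v0 f0 vf)).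
    by congr (_%:R); congr nat_of_bool; clear -mk np; lia.
apply: (@eType_chain _ _ _ (quo_form_alternating om_form _) _
  (quo_end_adj om_form x_adj iso st) K2 _ _ (to_quo om _ f')).
  by rewrite fibre_dim_quo.
apply: chain_pair_quo => //; first exact: fibre_v_perp.
have := fibre_vn Fib (j := n - k); rewrite subKn //; apply; exact: leq_subr.
Qed.

Definition cell : set flag := [set F : flag | fibre F /\
  forall k, (k <= n)%N -> phi_is F (n - k) (bishape_le k (T_ n (n - m)))].

Lemma cellP F : cell F <-> component F /\ ee m \notin F (inord m.+1).
Proof.
have im : (2 <= n - m <= n)%N by clear -np mp; lia.
have mn : (m <= n)%N by clear -np mp; lia.
split=> [[hF hphi]|[hF em]].
  apply: phi_component => //.
    have := hphi (n - m)%N (leq_subr _ _).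
    by rewrite (bishape_T im (leq_subr _ _)) ltnn subKn.
  have := hphi (n - m.+1)%N (leq_subr _ _).
  rewrite (bishape_T im (leq_subr _ _)).
  have -> : (n - m.+1 < n - m)%N by clear -np mp; lia.
  have -> : (n - (n - m.+1) = m.+1)%N by clear -np mp; lia.
  have h : (0 < n - m.+1)%N by clear -np mp; lia.
  by rewrite /= h.
split; first by case: hF.
move=> k kn; rewrite (bishape_T im kn); case: ltnP => hk.
  have := @component_phi_high F (n - k) hF em; rewrite subKn //; apply.
  by clear -hk kn mn; lia.
have := @component_phi_low F (n - k) hF; rewrite subKn //; apply.
by clear -hk kn mn; lia.
Qed.

(** * The closure of the cell *)

Lemma polyfun_om (E : vectType K) (h1 h2 : E -> V) :
  polymap h1 -> polymap h2 -> polyfun (fun a => om (h1 a) (h2 a)).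
Proof.
move=> p1 p2; pose B := vbasis {:V}.
have -> : (fun a => om (h1 a) (h2 a)) = (fun a =>
    \sum_(i < \dim {:V}) (fun a => coord B i (h1 a) *
      \sum_(j < \dim {:V}) (fun a => coord B j (h2 a) * om B`_i B`_j) a) a).
  apply/funext => a; rewrite {1}(coord_vbasis (memvf (h1 a))) (om_suml om_form).
  apply: eq_bigr => i _; rewrite (omZl om_form); congr (_ * _).
  rewrite {1}(coord_vbasis (memvf (h2 a))) (om_sumr om_form).
  by apply: eq_bigr => j _; rewrite (omZr om_form).
apply: polyfun_sum => i; apply: polyfun_mul; first exact: (p1 (coord B i)).
apply: polyfun_sum => j; apply: polyfun_mul; first exact: (p2 (coord B j)).
exact: polyfun_cst.
Qed.

Local Notation plane2 := ('rV[K]_2 * 'rV[K]_2)%type.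

Lemma polyfun_fst i : polyfun (fun st : plane2 => st.1 0 i).
Proof. by apply: polyfun_lin => c a b; rewrite !mxE. Qed.

Lemma polyfun_snd i : polyfun (fun st : plane2 => st.2 0 i).
Proof. by apply: polyfun_lin => c a b; rewrite !mxE. Qed.

Lemma polyfun_det2 y : polyfun (fun st : plane2 => det2 st.2 y).
Proof.
have -> : (fun st : plane2 => det2 st.2 y) =
    (fun st => st.2 0 0 * y 0 1 + st.2 0 1 * - y 0 0).
  by apply/funext => st; rewrite /det2 mulrN.
by apply: polyfun_add; apply: polyfun_mul;
  (exact: polyfun_snd || exact: polyfun_cst).
Qed.

Lemma polymap_frame g y : polymap (frame g y).
Proof.
have pmid (h : plane2 -> 'rV[K]_2) : (forall i, polyfun (fun st => h st 0 i)) ->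
    polymap (fun st : plane2 => mid g st.1 (h st)).
  move=> hh; apply: polymap_add; apply: polymap_scale => //.
  - apply: polyfun_mul => //; apply: polyfun_add;
      by apply: polyfun_mul; [exact: polyfun_cst | exact: polyfun_fst].
  - exact: polymap_cst.
  - by apply: polymap_add; apply: polymap_scale;
      [exact: polyfun_fst | exact: polymap_cst
      |exact: polyfun_fst | exact: polymap_cst].
apply: (polymap_ffun (f := fun (k : 'I_n.*2) (st : plane2) =>
  if (k < n)%N then lo g y st.1 st.2 k else hi g y st.2 (n.*2.-1 - k))) => k.
move: (n.*2.-1 - k)%N => l; move: (nat_of_ord k) => k'; case: (k' < n)%N.
  rewrite /lo; case: (k' < m)%N; first exact: polymap_cst.
  case: (k' == m); first by apply: pmid => i; apply: polyfun_snd.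
  case: (k' == m.+1); last exact: polymap_cst.
  by apply: (pmid (fun=> y)) => i; apply: polyfun_cst.
rewrite /hi; case: (l < m)%N; first exact: polymap_cst.
case: (l == m); first exact: polymap_cst.
case: (l == m.+1); last exact: polymap_cst.
have -> : (fun st : plane2 => comid g st.2) =
    (fun st => st.2 0 1 *: ff m + st.2 0 0 *: - wg g).
  by apply/funext => st; rewrite /comid scalerN.
by apply: polymap_add; apply: polymap_scale;
  (exact: polyfun_snd || exact: polymap_cst).
Qed.

(** [rho g] sends [ee m] to the first unit vector and F_{m+1} to the line of [st.2]. *)
Lemma frame_ee_mid g y st : dot g st.1 != 0 -> det2 st.2 y != 0 ->
  ee m \in flagof (frame g y st) (inord m.+1) -> st.2 0 1 = 0.
Proof.
move=> gs ty em; have : rho g (ee m) \in <[st.2]>%VS.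
  by rewrite -(frame_rho gs ty) -linfun_rho memv_img.
move=> /vlineP[l El].
have E1 : rho g (ee m) 0 1 = 0 by rewrite vec2_1 prj_ee /dot !mxE; ring.
have E0 : rho g (ee m) 0 0 = 1 by rewrite vec2_0 ee_ff // eqxx.
move: E0 E1; rewrite El !mxE => E0 /eqP;
  rewrite mulf_eq0 => /orP[/eqP l0|/eqP//].
by move: E0; rewrite l0 mul0r => /eqP; rewrite eq_sym oner_eq0.
Qed.

Local Notation fibre_variety := (subvariety (X := flags V n.*2) fibre).

Lemma frame_coords g y st : dot g st.1 != 0 -> det2 st.2 y != 0 ->
  coords (frame g y st : ambient (flags V n.*2)).
Proof.
by move=> gs ty; apply: (frame_basis om_form (frame_pair gs ty) dimV).
Qed.

(** F_m is the perpendicular space of F_{2n-m}, so the inclusion of x F_{m+2} in F_m amounts to the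
    vanishing of finitely many polynomials [om (b i) (x (b j))] in an adapted basis [b]. *)
Lemma component_open : zopen (X := fibre_variety)
  [set F | @points _ fibre_variety F /\ ~ component F].
Proof.
split=> [F []//|a [[ab aF] [_ ac]]].
pose bad (i j : 'I_n.*2) := [&& (i < n.*2 - m)%N, (j < m.+2)%N & om (a i) (x (a j)) != 0].
have [/existsP[i /existsP[j /and3P[hi hj ij]]]|nex] :=
    boolP [exists i, exists j, bad i j].
  exists (fun b : {ffun 'I_n.*2 -> V} => om (b i) (x (b j))); split => //.
    apply: polyfun_om; first exact: polymap_ffun_at.
    by apply: polymap_lin => c u u'; rewrite !ffunE linearP.
  move=> b [bb bF] q; split; first by split.
  split; first by exists b.
  move=> [_ xF]; move/eqP: q; apply.
  have bi : b i \in flagof b (inord (n.*2 - m)).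
    by apply: mem_flagof; rewrite inordK // ltnS leq_subr.
  have bj : x (b j) \in flagof b (inord m).
    apply: (subvP xF); apply: memv_img; apply: mem_flagof.
    by rewrite inordK //; clear -np mp; lia.
  by apply: (fibre_om om_form bF bi bj); clear -np mp; lia.
exfalso; apply: ac; split => //; apply/subvP => _ /memv_imgP[u hu ->].
rewrite memv_preim; move: u hu; apply/subvP/flagof_subP => j.
rewrite inordK => [jm|]; last by clear -np mp; lia.
rewrite -memv_preim.
have -> : m = (n.*2 - (n.*2 - m))%N by clear -np mp; lia.
rewrite -(fibre_perp aF) ?leq_subr //; apply: mem_perp_flagof => // i.
rewrite inordK => [im|]; last by rewrite ltnS leq_subr.
apply/eqP.
apply: contraNT nex => ij; apply/existsP; exists i; apply/existsP; exists j.
by rewrite /bad im jm ij.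
Qed.

Hypothesis K0 : [pchar K] =i pred0.

Lemma closure_cell : zclosure (X := fibre_variety) cell = component.
Proof.
apply/seteqP; split=> F.
  move=> [FX Fcl]; apply: contrapT => nF.
  have [G [[_ nG] /cellP[]]] := Fcl _ component_open (conj FX nF).
  by [].
move=> hF; have [s s0 hs] := component_frame hF; have [g gs] := exists_dot s0.
have [t t0 ht] := hs g gs; have [y ty] := exists_det2 t0.
have FE := ht y ty.
have coordsF t' : det2 t' y != 0 ->
    coords (frame g y (s, t') : ambient fibre_variety).
  move=> ty'; split; first exact: (frame_coords (st := (s, t'))).
  by have [] := frame_component (st := (s, t')) gs ty'.
split; first by rewrite FE; exists (frame g y (s, t)); [exact: coordsF|].
move=> W [Wsub Wopen] WF.
have [em|em] := boolP (ee m \in F (inord m.+1)); last first.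
  by exists F; split => //; apply/cellP.
have t10 : t 0 1 = 0.
  by move: em; rewrite FE; apply: (frame_ee_mid (st := (s, t))).
have [|q [hq qa hW]] := Wopen (frame g y (s, t)).
  by split; [exact: coordsF | rewrite -FE].
(* Replacing [t] by [t + c y] does not change [det2 t y], so the frame remains valid. Since [t 0 1]
   is 0 and [y 0 1] is not, any nonzero [c] moves the flag into the cell. *)
have [c c0 qc] := polyfun_nonroot_line (a := (s, t)) (0, y) K0
  (polyfun_comp (polymap_frame g y) hq) qa.
have Ec : (s, t) + c *: (0, y) = (s, t + c *: y) :> plane2.
  by congr pair; rewrite /= ?scaler0 ?addr0.
rewrite Ec in qc.
have ty' : det2 (t + c *: y) y != 0.
  suff -> : det2 (t + c *: y) y = det2 t y by [].
  by rewrite /det2 !mxE; ring.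
have [hG WG] := hW _ (coordsF _ ty') qc.
exists (flagof (frame g y (s, t + c *: y))); split => //.
apply/cellP; split; first exact: (frame_component (st := (s, _)) gs ty').
apply/negP => /(frame_ee_mid (st := (s, _)) gs ty').
rewrite /= !mxE t10 add0r => /eqP; rewrite mulf_eq0 (negbTE c0) /=.
apply/negP; apply: contraNneq ty => y0.
by rewrite /det2 t10 y0 mulr0 mul0r subrr.
Qed.

(* A line [h @: F k] is spanned by [h (a j)] for any vector [a j] of an adapted
   basis on which [h] does not vanish. *)
Lemma line_lift (h : V -> 'rV[K]_2) k (S : set flag) : linear h ->
  (k < (n.*2).+1)%N ->
  (forall F, S F -> exists2 s : 'rV[K]_2, s != 0 &
     (linfun h @: F (inord k) = <[s]>)%VS) ->
  forall a : {ffun 'I_n.*2 -> V}, S (flagof a) ->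
  exists (phi : {ffun 'I_n.*2 -> V} -> 'rV[K]_2) (q : {ffun 'I_n.*2 -> V} -> K),
  [/\ polymap phi, polyfun q, q a != 0 & forall b, S (flagof b) -> q b != 0 ->
     phi b != 0 /\ (<[phi b]> = linfun h @: flagof b (inord k))%VS].
Proof.
move=> hlin kn hS a Sa.
have hE u : linfun h u = h u.
  pose l : {linear V -> 'rV[K]_2} :=
    HB.pack h (GRing.isLinear.Build _ _ _ _ h hlin).
  exact: (lfunE l).
have [j jk hj] : exists2 j : 'I_n.*2, (j < k)%N & h (a j) != 0.
  have [/existsP[j /andP[]]|nex] := boolP [exists j : 'I_n.*2, (j < k)%N && (h (a j) != 0)].
    by exists j.
  have [s s0 E] := hS _ Sa; exfalso; move/negP: s0; apply.
  have : (linfun h @: flagof a (inord k) <= 0)%VS.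
    apply/subvP => _ /memv_imgP[u hu ->].
    rewrite memv_preim; move: u hu; apply/subvP/flagof_subP => j.
    rewrite inordK // => jk; rewrite -memv_preim hE memv0.
    by apply: contraNT nex => hj; apply/existsP; exists j; rewrite jk.
  by rewrite E -memvE memv0.
have [i hi] : exists i, h (a j) 0 i != 0.
  by move: hj; rewrite row2_neq0 => /orP[]; [exists 0 | exists 1].
exists (fun b => h (b j)), (fun b => h (b j) 0 i); split => //.
- by apply: polymap_lin => c u u'; rewrite !ffunE hlin.
- by apply: polyfun_lin => c u u'; rewrite !ffunE hlin !mxE.
move=> b Sb hb; have hb0 : h (b j) != 0.
  by apply: contraNneq hb => ->; rewrite mxE.
split => //; have [s s0 E] := hS _ Sb; rewrite E; apply: line_gen => //.
by rewrite -E -hE memv_img // mem_flagof // inordK.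
Qed.

(** With [g] arbitrary, every point of P^1 has such a chart around it, and no pair of standard
    charts has to be singled out. *)
Definition base_chart (g : 'rV[K]_2) : set {vspace 'rV[K]_2} :=
  [set L | exists2 s : 'rV[K]_2, L = <[s]>%VS & dot g s != 0].

Lemma base_chart_line g s : base_chart g <[s]>%VS -> dot g s != 0.
Proof.
move=> [s' E gs']; have : s' \in <[s]>%VS by rewrite E memv_line.
by move=> /vlineP[c Es']; move: gs';
  rewrite Es' dotZ mulf_eq0 negb_or => /andP[].
Qed.

Lemma base_chart_open g : zopen (X := P1 K) (base_chart g).
Proof.
split=> [L [s -> gs]|a [a0 /base_chart_line ga]].
  by exists s => //; apply: dot_neq0 gs.
exists (dot g); split => //.
  have -> : dot g = (fun s => g 0 0 * s 0 0 + g 0 1 * s 0 1) by [].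
  by apply: polyfun_add; apply: polyfun_mul; try exact: polyfun_cst;
    apply: polyfun_lin => c u u'; rewrite !mxE.
by move=> b b0 gb; split => //; exists b.
Qed.

(** * The bundle structure *)

Local Notation component_variety := (subvariety (X := flags V n.*2) component).
Local Notation base F := (linfun prj @: F (inord n))%VS.
Local Notation fibre_line g F := (linfun (rho g) @: F (inord m.+1))%VS.

Lemma component_chart g F : component F -> base_chart g (base F) ->
  exists s t, [/\ dot g s != 0, t != 0, base F = <[s]>%VS,
    fibre_line g F = <[t]>%VS &
    forall y, det2 t y != 0 -> F = flagof (frame g y (s, t))].
Proof.
move=> hF; have [s s0 hs] := component_frame hF.
have -> : base F = <[s]>%VS.
  have [g' gs'] := exists_dot s0; have [t t0 ht] := hs g' gs'.
  have [y ty] := exists_det2 t0.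
  by rewrite (ht y ty); apply: (frame_prj (st := (s, t))).
move=> /base_chart_line gs; have [t t0 ht] := hs g gs;
  have [y ty] := exists_det2 t0.
exists s, t; split => //.
by rewrite (ht y ty); apply: (frame_rho (st := (s, t))).
Qed.

Lemma component_base F : component F ->
  exists2 s : 'rV[K]_2, s != 0 & base F = <[s]>%VS.
Proof.
move=> hF; have [s s0 hs] := component_frame hF; have [g gs] := exists_dot s0.
have [t t0 ht] := hs g gs; have [y ty] := exists_det2 t0.
by exists s => //; rewrite (ht y ty); apply: (frame_prj (st := (s, t))).
Qed.

(** Equal lines have generators that differ by scalars, to which the flag of a frame is
    insensitive. *)
Lemma chart_inj g F G : component F -> component G -> base_chart g (base F) ->
  base F = base G -> fibre_line g F = fibre_line g G -> F = G.
Proof.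
move=> hF hG cF E E'; have cG : base_chart g (base G) by rewrite -E.
have [s [t [gs t0 Es Et hf]]] := component_chart hF cF.
have [s' [t' [gs' t'0 Es' Et' hg]]] := component_chart hG cG.
rewrite Es Es' in E; rewrite Et Et' in E'.
have [c c0 Ec] := eq_line (dot_neq0 gs) (dot_neq0 gs') E.
have [c' c'0 Ec'] := eq_line t0 t'0 E'.
have [y ty] := exists_det2 t0.
rewrite (hf y ty) (hg y) ?Ec ?Ec' ?frame_scale //.
by rewrite det2Z mulf_neq0.
Qed.

Lemma component_P1_bundle : is_P1_bundle_over component_variety (P1 K).
Proof.
have n2 : (n < (n.*2).+1)%N by rewrite ltnS -addnn leq_addr.
have m2 : (m.+1 < (n.*2).+1)%N by clear -np mp; lia.
exists (fun F : flag => base F); split.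
  apply: morphism_of_lifts => a [_ Ca].
  have [phi [q [h1 h2 h3 h4]]] := line_lift prj_linear n2 component_base Ca.
  by exists phi, q; split => // b [_ Cb] qb; apply: h4.
move=> _ [s0 s00 <-]; have [g gs0] := exists_dot s00.
exists (base_chart g); split; [exact: base_chart_open | by exists s0 |].
exists (fun F : flag => (base F, fibre_line g F)); split => //.
apply: isomorphism_of_lifts.
- exact: [ffun=> 0%VS].
- move=> a [[_ Ca] [_ Wa]].
  have [phi [q [h1 h2 h3 h4]]] := line_lift prj_linear n2 component_base Ca.
  (* The image of F_{m+1} under [rho g] is known to be a line only over the chart of [g], hence the
     restriction to [S]. *)
  pose S := [set F : flag | component F /\ base_chart g (base F)].
  have hS F : S F -> exists2 t : 'rV[K]_2, t != 0 & fibre_line g F = <[t]>%VS.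
    by move=> [hF cF]; have [s [t [_ t0 _ Et _]]] := component_chart hF cF;
      exists t.
  have [|phi' [q' [h1' h2' h3' h4']]] := line_lift (rho_linear g) m2 hS (a := a).
    by split.
  exists (fun b => (phi b, phi' b)), (fun b => q b * q' b); split.
  + exact: polymap_pair.
  + exact: polyfun_mul.
  + by rewrite mulf_neq0.
  + move=> b [[_ Cb] [_ Wb]]; rewrite mulf_eq0 negb_or => /andP[qb q'b].
    have [pb0 pbE] := h4 b Cb qb; have [pb'0 pb'E] := h4' b (conj Cb Wb) q'b.
    split; last by rewrite /= -pbE -pb'E.
    by split => //; split => //; rewrite /= pbE.
- move=> [s t] [[/= s_0 /base_chart_line gs] t0].
  (* [dot g s] is nonzero over the whole base chart, so only the fibre coordinate has to be
     restricted: [frame g y] is a lift wherever [det2 t y] is nonzero. *)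
  have [y ty] := exists_det2 t0.
  exists (frame g y), (fun st => det2 st.2 y); split => //.
  + exact: polymap_frame.
  + exact: polyfun_det2.
  + move=> [s' t'] [[/= s'0 /base_chart_line gs'] t'0] ty'.
    have Eb := frame_prj (st := (s', t')) gs' ty'.
    have Er := frame_rho (st := (s', t')) gs' ty'.
    split; last by rewrite /= Eb Er.
    have Xf : coords (frame g y (s', t') : ambient component_variety).
      split; first exact: (frame_coords (st := (s', t'))).
      exact: (frame_component (st := (s', t'))).
    split => //; split; first by exists (frame g y (s', t')).
    by rewrite /= Eb; exists s'.
- move=> _ _ [a [[_ Ca] [_ Wa]] <-] [b [[_ Cb] _] <-] [E E'].
  exact: chart_inj Ca Cb Wa E E'.
Qed.

End Component.

Lemma sform_alternating (K : fieldType) (U : vectType K) :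
  alternating_form (@sform K U).
Proof.
split => [c k a b|c k a b|a]; rewrite /sform /=.
- rewrite linearP add_lfunE scale_lfunE -![k *: _]/(k * _).
  by rewrite mulrBr opprD addrACA.
- rewrite linearP add_lfunE scale_lfunE -![k *: _]/(k * _).
  by rewrite mulrBr opprD addrACA.
- by rewrite subrr.
Qed.

Theorem proposition8p2 (R : realType) (U : vectType R[i]) (n : nat)
    (v : plus_dual U) (x : 'End(plus_dual U)) (i : nat) :
  (2 <= n)%N ->
  \dim {:U} = n ->
  exotic_nilcone (@sform _ U) v x ->
  eType (@sform _ U) v x ([:: n.-1; 1%N], [::]) ->
  (2 <= i <= n)%N ->
  is_P1_bundle_over
    (@subvariety _ (flags (plus_dual U) n.*2)
       (closure_in_fibre v x (@Phi_preim _ U n v x (T_ n i))))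
    (P1 R[i]).
Proof.
move=> n2 _ [x_adj _] hv /andP[i2 iN].
have K0 : [pchar R[i]] =i pred0 by exact: Num.Theory.pchar_num.
have K2 : (2%:R : R[i]) != 0 by rewrite Num.Theory.pnatr_eq0.
have om_form := sform_alternating U.
have [p np] : exists p, n = p.+2 by exists n.-2; lia.
have n1 : (0 < n.-1)%N by lia.
have [dimV [f [z [w nf]]]] := eType_row2_inv om_form n1 hv.
have dimV' : \dim {:plus_dual U} = n.*2 by rewrite dimV prednK //; lia.
have nf' : normal_frame (@sform _ U) x p.+1 v f z w by move: nf; rewrite np.
have mp : (n - i <= p)%N by lia.
(* For [m = n - i] the set [cell] is convertible to [Phi_preim], once [n - (n - i)] is rewritten to
   [i]. *)
have -> : closure_in_fibre v x (@Phi_preim _ U n v x (T_ n i)) =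
    @component _ _ (@sform _ U) x (n - i) n v.
  rewrite -(closure_cell om_form x_adj K2 np mp dimV' nf' K0).
  by rewrite /cell subKn.
exact: (component_P1_bundle om_form x_adj K2 np mp dimV' nf').
Qed.
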